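(* Let $H=(V,E)$ be a hypergraph with weight function $w:E\to\mathbb{R}_{\ge0}$, let $r$ be the maximum size of a hyperedge, and let $k\ge 2$. Then \[ \frac1k\sigma_k^*(H)\lesssim\phi_k(H)\lesssim k^4\log k\sqrt{\log r\cdot\sigma_k^*(H)}, \] and for any $\epsilon\ge 1/k$, \[ \phi_{(1-\epsilon)k}(H)\lesssim\frac{1}{\epsilon^4}\log k\sqrt{\log r\cdot\sigma_k^*(H)}. \]
   Context: Notation: $f\lesssim g$ means $f\le c\,g$ for an absolute constant $c$. For $S\subseteq V$, $\delta(S)=\{e\in E:e\cap S\ne\emptyset,e\cap\overline S\ne\emptyset\}$, $d_w(v)=\sum_{e\ni v}w(e)$, ${\rm vol}_w(S)=\sum_{v\in S}d_w(v)$, $\phi(S)=\frac{w(\delta(S))}{\min\{{\rm vol}_w(S),{\rm vol}_w(\overline S)\}}$. The $k$-way edge conductance is $\phi_k(H)=\min_{S_1,\dots,S_k}\max_i\phi(S_i)$ over pairwise disjoint nonempty $S_1,\dots,S_k\subseteq V$. Let $D=\mathrm{diag}(d_w)$. Feasible reweightings: nonnegative variables $c(u,v,e)$ for each hyperedge $e$ and pair $\{u,v\}\subseteq e$ with $\sum_{\{u,v\}\subseteq e}c(u,v,e)\le w(e)$ for every $e$, $A(u,v)=\sum_{e\ni u,v}c(u,v,e)$, and $D_A=\mathrm{diag}(\sum_uA(u,v))$. Then $\sigma_k^*(H)$ is the maximum over feasible reweightings of the sum of the $k$ smallest eigenvalues of $D^{-1/2}(D_A-A)D^{-1/2}$. 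*)

(* Defs.v *)
From HB Require Import structures.
From mathcomp Require Import all_boot all_order all_algebra.
From mathcomp Require Import all_classical all_reals exp.
From mathcomp Require Import polyrcf finset.

Set Implicit Arguments.
Unset Strict Implicit.
Unset Printing Implicit Defensive.
Import Order.TTheory GRing.Theory Num.Theory.
Local Open Scope ring_scope.

Section Hypergraph.
Context {R : realType} {V : finType}.
(* Only the values of [w] on [E] are ever used. *)
Variables (E : {set {set V}}) (w : {set V} -> R).

Definition rank_hyper : nat := \max_(e in E) #|e|.

Definition boundary (S : {set V}) : {set {set V}} :=
  [set e in E | (e :&: S != set0) && (e :&: ~: S != set0)].

Definition wdeg (v : V) : R := \sum_(e in E | v \in e) w e.

Definition wvol (S : {set V}) : R := \sum_(v in S) wdeg v.

Definition conductance (S : {set V}) : R :=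
  (\sum_(e in boundary S) w e) / Num.min (wvol S) (wvol (~: S)).

(* [S i != setT] follows from disjointness and nonemptiness when [k >= 2]; for
   [k = 1] it discards the set V, whose conductance is the undefined 0 / 0. *)
Definition kway_family (k : nat) (S : 'I_k -> {set V}) : Prop :=
  (forall i, S i != set0 /\ S i != setT)
  /\ (forall i j, i != j -> [disjoint S i & S j]).

(* The infimum ranges over a finite set of values, hence is a minimum when
   [kway_family] is inhabited; conductances being nonnegative, the default
   value 0 of the maximum is harmless. *)
Definition kway_conductance (k : nat) : R :=
  inf [set x | exists2 S : 'I_k -> {set V}, kway_family S &
                 x = \big[Num.max/0]_(i < k) conductance (S i)]%classic.

Definition pairs_in (e : {set V}) : {set {set V}} :=
  [set p : {set V} | (#|p| == 2)%N & p \subset e].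

(* [c p e] is c(u,v,e) for the unordered pair p = {u,v}. *)
Definition feasible (c : {set V} -> {set V} -> R) : Prop :=
  forall e, e \in E ->
    (forall p, p \in pairs_in e -> 0 <= c p e)
    /\ \sum_(p in pairs_in e) c p e <= w e.

Definition radj (c : {set V} -> {set V} -> R) (u v : V) : R :=
  if u == v then 0
  else \sum_(e in E | [set u; v] \subset e) c [set u; v] e.

(* Matrices indexed by V are matrices of size #|V|, through [enum_val]. *)
Definition radj_mx (c : {set V} -> {set V} -> R) : 'M[R]_#|V| :=
  \matrix_(i, j) radj c (enum_val i) (enum_val j).

Definition rdeg_mx (c : {set V} -> {set V} -> R) : 'M[R]_#|V| :=
  diag_mx (\row_i \sum_(u : V) radj c u (enum_val i)).

Definition wdeg_invsqrt_mx : 'M[R]_#|V| :=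
  diag_mx (\row_i (Num.sqrt (wdeg (enum_val i)))^-1).

Definition nlaplacian (c : {set V} -> {set V} -> R) : 'M[R]_#|V| :=
  wdeg_invsqrt_mx *m (rdeg_mx c - radj_mx c) *m wdeg_invsqrt_mx.

End Hypergraph.

(* The real eigenvalues in nondecreasing order, each repeated according to its
   algebraic multiplicity; all [n] eigenvalues when [M] is symmetric. *)
Definition real_eigenvalues {R : rcfType} {n : nat} (M : 'M[R]_n) : seq R :=
  flatten [seq nseq (mup x (char_poly M)) x | x <- rootsR (char_poly M)].

Definition sum_smallest_eigenvalues {R : rcfType} {n : nat} (k : nat)
    (M : 'M[R]_n) : R :=
  \sum_(x <- take k (real_eigenvalues M)) x.

(* The supremum is attained: the value of [sum_smallest_eigenvalues] depends
   continuously on the coordinates c(u,v,e) that matter, which range over a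
   nonempty compact set. *)
Definition sigma_star {R : realType} {V : finType} (E : {set {set V}})
    (w : {set V} -> R) (k : nat) : R :=
  sup [set x | exists2 c : {set V} -> {set V} -> R, feasible E w c &
                 x = sum_smallest_eigenvalues k (nlaplacian E w c)]%classic.

(* Main.v *)
Require Import Defs.
From HB Require Import structures.
From mathcomp Require Import all_boot all_order all_algebra.
From mathcomp Require Import all_classical all_reals sequences exp.
From mathcomp Require Import sesquilinear spectral complex polyrcf ring lra.
Set Implicit Arguments.
Unset Strict Implicit.
Unset Printing Implicit Defensive.
Import Order.TTheory GRing.Theory Num.Theory.
Local Open Scope ring_scope.

(* The number [sigma] is the value of a game between the reweighting [c] and a projection of rank
   [k]; playing it with multiplicative weights yields vectors [f v] with
   [sum_v d v f(v) f(v)^T <= Id], [sum_v d v |f v|^2 = k] and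
   [sum_e w e max_(u, v in e) |f u - f v|^2 <= sigma + delta].
   To find sparse sets, hash the directions [f v / |f v|] by the sides on which they fall of
   independent random cuts [<s, x> > t], with [s] a random sign vector and [t] a uniform threshold;
   there are enough of them for two far directions to be separated [10 ln k] times on average.
   Sub-isotropy bounds by [1 + O (eps)] the mass of the vectors with directions close to a given
   one, and far directions collide with probability at most [k^-10], so every cell has mass at
   most [1 + eps / 8]. A hyperedge is split by a cut with probability proportional to
   [E max_(u, v in e) |<s, x_u - x_v>|], which costs the factor [sqrt (ln r)]. Merging light cells
   gives almost [k] disjoint groups of mass at least 1/4; in each, Cheeger's argument picks a
   level set of [|f v|^2]. Hyperedges which are long with respect to the hashing scale have
   [max_e |f|^2] controlled by their own energy. *)

(** * Sums of smallest eigenvalues *)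

Section SpectralReal.
Local Open Scope sesquilinear_scope.
Variables (R : rcfType) (n : nat).
Local Notation toC := (real_complex R).
Local Notation C := (R[i])%C.

Lemma sym_unitary_diag (M : 'M[R]_n) : M^T = M ->
  exists (U : 'M[C]_n) (d : 'rV[R]_n), [/\ U *m U^t* = 1%:M, U^t* *m U = 1%:M &
    map_mx toC M = U^t* *m diag_mx (map_mx toC d) *m U].
Proof.
move=> symM.
have hM : map_mx toC M \is hermsymmx.
  apply: realsym_hermsym.
    apply/is_hermitianmxP; rewrite expr0 scale1r map_mx_id //.
    by rewrite map_trmx symM.
  by apply/mxOverP => i j; rewrite mxE; apply/complex_realP; exists (M i j).
pose U := spectralmx (map_mx toC M); pose D := spectral_diag (map_mx toC M).
have Uu : U \is unitarymx by exact: spectral_unitarymx.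
have rD := hermitian_spectral_diag_real hM.
exists U, (map_mx (@complex.Re R) D); split.
- exact/unitarymxP.
- by have := unitarymx_unit Uu; rewrite -invmx_unitary // => /mulVmx.
have -> : map_mx toC (map_mx (@complex.Re R) D) = D.
  by apply/rowP => j; rewrite !mxE RRe_real // (mxOverP rD).
rewrite -invmx_unitary //; apply/orthomx_spectralP.
exact: hermitian_normalmx.
Qed.

Lemma sym_unitary_diag_char_poly (M : 'M[R]_n) (U : 'M[C]_n) (d : 'rV[R]_n) :
  U^t* *m U = 1%:M -> map_mx toC M = U^t* *m diag_mx (map_mx toC d) *m U ->
  char_poly M = \prod_i ('X - (d 0 i)%:P).
Proof.
move=> UU ME; apply: (map_poly_inj toC); rewrite map_char_poly ME.
have := char_poly_trig (diag_mx_is_trig (map_mx toC d)).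
rewrite rmorph_prod /=.
under eq_bigr do rewrite !mxE eqxx mulr1n.
under [in X in _ -> _ = X]eq_bigr do rewrite rmorphB /= map_polyX map_polyC /=.
move=> <-; rewrite /char_poly /char_poly_mx.
have UU' : map_mx polyC (U^t*) *m map_mx polyC U = 1%:M.
  by rewrite -map_mxM UU map_mx1.
have -> : 'X%:M - map_mx polyC (U^t* *m diag_mx (map_mx toC d) *m U) =
  map_mx polyC (U^t*) *m ('X%:M - map_mx polyC (diag_mx (map_mx toC d))) *m map_mx polyC U.
  rewrite mulmxBr mulmxBl !map_mxM; congr (_ - _).
  by rewrite scalar_mxC -mulmxA UU' mulmx1.
by rewrite !det_mulmx mulrAC -det_mulmx UU' det1 mul1r.
Qed.

(* [B] records the imaginary parts: [Q + iB] is a complex orthogonal projection. *)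
Lemma real_part_projection (M : 'M[R]_n) (U : 'M[C]_n) (d : 'rV[R]_n) (I : {set 'I_n}) :
  U *m U^t* = 1%:M -> U^t* *m U = 1%:M ->
  map_mx toC M = U^t* *m diag_mx (map_mx toC d) *m U ->
  exists Q B : 'M[R]_n, [/\ Q = Q *m Q^T + B *m B^T, \tr Q = #|I|%:R &
    \tr (M *m Q) = \sum_(i in I) d 0 i].
Proof.
move=> UU UU' ME.
pose J : 'M[C]_n := diag_mx (\row_i (i \in I)%:R).
pose P := U^t* *m J *m U.
have JJ : J *m J = J.
  rewrite mul_diag_mx; apply/matrixP => i j; rewrite !mxE.
  by case: eqP => [->|_]; rewrite ?mulr0n ?mulr0 // !mulr1n -natrM mulnb andbb.
have PP : P *m P = P.
  by rewrite /P !mulmxA -(mulmxA _ U) UU mulmx1 -(mulmxA _ J J) JJ.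
have PH : P^t* = P.
  rewrite /P !trmx_mul !map_mxM trmxCK mulmxA; congr (_ *m _ *m _).
  rewrite tr_diag_mx map_diag_mx; congr diag_mx.
  by apply/rowP => i; rewrite !mxE rmorph_nat.
have trP : \tr P = #|I|%:R.
  rewrite /P mxtrace_mulC mulmxA UU mul1mx mxtrace_diag.
  under eq_bigr do rewrite mxE.
  rewrite -natr_sum -sum1_card [in RHS]big_mkcond.
  by congr (_%:R); apply: eq_bigr => i _; case: (i \in I).
have trMP : \tr (map_mx toC M *m P) = toC (\sum_(i in I) d 0 i).
  rewrite ME /P !mulmxA -(mulmxA _ U) UU mulmx1 -mulmxA mxtrace_mulC.
  rewrite mulmxA -(mulmxA J) UU mulmx1.
  rewrite mul_diag_mx /mxtrace [in RHS]big_mkcond rmorph_sum; apply: eq_bigr => i _.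
  by rewrite !mxE eqxx mulr1n; case: (i \in I); rewrite ?mul1r ?mul0r.
clearbody P.
pose Q := map_mx (@complex.Re R) P; pose B := map_mx (@complex.Im R) P.
have PHE i j : P j i = conjc (P i j) by rewrite -[in LHS]PH !mxE.
exists Q, B; split.
- apply/matrixP => i j; rewrite !mxE -[in LHS]PP !mxE raddf_sum -big_split /=.
  apply: eq_bigr => l _; rewrite !mxE (PHE j l).
  by case: (P i l) (P j l) => [a b] [a' b'] /=; rewrite mulrN opprK.
- move: trP => /(congr1 (@complex.Re R)); rewrite /mxtrace raddf_sum /=.
  rewrite -(rmorph_nat (real_complex R)) /= => <-; apply: eq_bigr => i _; by rewrite mxE.
- move: trMP => /(congr1 (@complex.Re R)); rewrite [in RHS]/= => <-.
  rewrite /mxtrace raddf_sum; apply: eq_bigr => i _.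
  rewrite !mxE raddf_sum; apply: eq_bigr => j _; rewrite !mxE.
  by case: (P j i) => a b /=; rewrite mul0r subr0.
Qed.

Lemma trace_projection_spectral (M Q : 'M[R]_n) (U : 'M[C]_n) (d : 'rV[R]_n) :
  U *m U^t* = 1%:M -> U^t* *m U = 1%:M ->
  map_mx toC M = U^t* *m diag_mx (map_mx toC d) *m U ->
  Q^T = Q -> Q *m Q = Q ->
  exists2 q : 'I_n -> R, forall i, 0 <= q i <= 1 &
    \sum_i q i = \tr Q /\ \tr (M *m Q) = \sum_i d 0 i * q i.
Proof.
move=> UU UU' ME symQ QQ.
pose H := U *m map_mx toC Q *m U^t*.
have HH : H *m H = H.
  by rewrite /H !mulmxA -(mulmxA _ (U^t*)) UU' mulmx1 -(mulmxA _ (map_mx toC Q) (map_mx toC Q)) -map_mxM QQ.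
have HC : H^t* = H.
  rewrite /H !trmx_mul !map_mxM trmxCK mulmxA; congr (_ *m _ *m _).
  rewrite map_trmx symQ; apply/matrixP => i j; rewrite !mxE.
  by apply: conjc_real.
have HCE i j : H j i = conjc (H i j) by rewrite -[in LHS]HC !mxE.
have HI i : complex.Im (H i i) = 0.
  by move: (HCE i i); case: (H i i) => a b /= [] ? /=; lra.
exists (fun i => complex.Re (H i i)) => [i|].
- have : complex.Re (H i i) = \sum_j (complex.Re (H i j) ^+ 2 + complex.Im (H i j) ^+ 2).
    rewrite -[in LHS]HH !mxE raddf_sum; apply: eq_bigr => j _; rewrite (HCE i j).
    by case: (H i j) => a b /=; rewrite mulrN opprK !expr2.
  rewrite (bigD1 i) //= HI => E.
  have : 0 <= \sum_(j | j != i) (complex.Re (H i j) ^+ 2 + complex.Im (H i j) ^+ 2).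
    by apply: sumr_ge0 => j _; rewrite addr_ge0 // sqr_ge0.
  by move: E; set x := complex.Re _; set y := \sum_(_ | _) _ => E y0; nra.
- have HE i : H i i = toC (complex.Re (H i i)).
    by rewrite [LHS]complexE HI /= mulr0 addr0.
  split; apply: (@complexI R).
    rewrite rmorph_sum /=; under eq_bigr do rewrite -HE.
    rewrite -/(\tr H) /H mxtrace_mulC mulmxA UU' mul1mx /mxtrace rmorph_sum.
    by apply: eq_bigr => i _; rewrite mxE.
  have -> : toC (\tr (M *m Q)) = \tr (map_mx toC M *m map_mx toC Q).
    by rewrite -map_mxM /mxtrace rmorph_sum; apply: eq_bigr => i _; rewrite [RHS]mxE.
  rewrite ME -!mulmxA mxtrace_mulC -mulmxA -/H.
  rewrite mul_diag_mx /mxtrace rmorph_sum; apply: eq_bigr => i _.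
  by rewrite [RHS]rmorphM /= -HE [LHS]mxE [X in X * _]mxE.
Qed.
End SpectralReal.

Section Poly.
Variable R : rcfType.
Implicit Types (s : seq R) (x : R).

Lemma mup_prod_XsubC x s : mup x (\prod_(y <- s) ('X - y%:P)) = count_mem x s.
Proof.
elim: s => [|y s IH].
  by rewrite big_nil mupNroot ?root1.
rewrite big_cons mupM ?polyXsubC_eq0 //; last first.
  by apply/monic_neq0/monic_prod_XsubC.
by rewrite IH -['X - _]expr1 mup_XsubCX /=; case: eqP.
Qed.

Lemma count_flatten_nseq (m : R -> nat) x s : uniq s ->
  count_mem x (flatten [seq nseq (m y) y | y <- s]) = (if x \in s then m x else 0)%N.
Proof.
elim: s => [//|y s IH] /= /andP[ys us].
rewrite count_cat IH // count_nseq /= inE eq_sym.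
by case: eqP => [->|_] /=; [rewrite (negPf ys) mul1n addn0 | rewrite mul0n].
Qed.

Lemma sorted_flatten_nseq (m : R -> nat) s : sorted <%R s ->
  sorted <=%R (flatten [seq nseq (m y) y | y <- s]).
Proof.
rewrite (sorted_pairwise lt_trans) (sorted_pairwise le_trans).
elim: s => [//|y s IH] /= /andP[ys us].
rewrite pairwise_cat IH // andbT; apply/andP; split; last first.
  apply/(pairwiseP 0) => i j; rewrite !inE size_nseq => im jm _.
  by rewrite !nth_nseq im jm.
apply/allrelP => a b /nseqP[-> _] /flattenP[t /mapP[z zs ->] /nseqP[-> _]].
by apply/ltW; move/allP: ys => /(_ _ zs).
Qed.

Lemma real_eigenvalues_perm n (M : 'M[R]_n) s :
  char_poly M = \prod_(x <- s) ('X - x%:P) ->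
  perm_eq (real_eigenvalues M) s /\ sorted <=%R (real_eigenvalues M).
Proof.
move=> E; rewrite /real_eigenvalues E; set p := \prod_(_ <- _) _.
have p0 : p != 0 by apply/monic_neq0/monic_prod_XsubC.
split; last by apply: sorted_flatten_nseq; apply: sorted_roots.
apply/allP => x _ /=; rewrite (@count_flatten_nseq (fun x => mup x p)) ?uniq_roots //.
rewrite mup_prod_XsubC; case: ifP => // /negbT.
rewrite -roots_on_rootsR // root_prod_XsubC => /count_memPn ->.
by [].
Qed.
End Poly.

Section KyFan.
Variables (R : rcfType) (n k : nat) (M : 'M[R]_n).
Hypotheses (symM : M^T = M) (k_gt0 : (0 < k)%N) (k_le_n : (k <= n)%N).

Lemma perm_map_preimage (T : eqType) (S : eqType) (f : T -> S) (s : seq S) (t : seq T) :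
  perm_eq s (map f t) -> exists2 t', perm_eq t' t & s = map f t'.
Proof.
case: t => [/perm_nilP->|x0 t st]; first by exists [::].
have /(perm_iotaP (f x0))[Is pI ->] := st.
rewrite size_map in pI.
exists (map (nth x0 (x0 :: t)) Is).
  apply: perm_trans (perm_map _ pI) _.
  by rewrite map_nth_iota0 // take_size.
rewrite -map_comp; apply/eq_in_map => i.
rewrite (perm_mem pI) mem_iota add0n => /= lti.
by rewrite -(nth_map x0 (f x0)).
Qed.

Lemma take_sorted_le (L : seq 'I_n) (d : 'I_n -> R) : sorted <=%R (map d L) ->
  uniq L -> size L = n ->
  exists theta, forall i, if i \in take k L then d i <= theta else theta <= d i.
Proof.
move=> sL uL szL.
have i0 : 'I_n by exists 0%N; exact: leq_trans k_gt0 k_le_n.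
exists (d (nth i0 L k.-1)) => i.
have iL : i \in L.
  have /uniq_min_size : uniq (enum 'I_n) by exact: enum_uniq.
  have : {subset L <= enum 'I_n} by move=> j _; rewrite mem_enum.
  move=> sub; have [//|_ ->] := uniq_min_size uL sub; rewrite ?mem_enum //.
  by rewrite -cardE card_ord szL.
have ltk : (k.-1 < size L)%N by rewrite szL prednK.
have mono a b : (a <= b)%N -> (b < size L)%N -> d (nth i0 L a) <= d (nth i0 L b).
  move=> ab bL; have aL := leq_ltn_trans ab bL.
  have := sorted_leq_nth le_trans lexx (d i0) sL.
  move=> /(_ a b); rewrite !inE size_map => /(_ aL bL ab).
  by rewrite !(nth_map i0).
have Ei : nth i0 L (index i L) = i by rewrite nth_index.
have lti : (index i L < size L)%N by rewrite index_mem.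
rewrite in_take // -{2 3}Ei; case: ifP => Hk; apply: mono => //.
  by rewrite -ltnS prednK.
by apply: leq_trans (leq_pred k) _; rewrite leqNgt Hk.
Qed.

Lemma sym_spectral_sorted : exists (U : 'M[R[i]%C]_n) (d : 'rV[R]_n) (L : seq 'I_n),
  [/\ U *m (map_mx Num.conj U^T) = 1%:M, (map_mx Num.conj U^T) *m U = 1%:M,
    map_mx (real_complex R) M = (map_mx Num.conj U^T) *m diag_mx (map_mx (real_complex R) d) *m U &
    [/\ uniq L, size L = n, sorted <=%R [seq d 0 i | i <- L] &
      sum_smallest_eigenvalues k M = \sum_(i <- take k L) d 0 i]].
Proof.
have [U [d [UU UU' ME]]] := sym_unitary_diag symM.
have := sym_unitary_diag_char_poly UU' ME.
rewrite -(big_map (fun i => d 0 i) xpredT (fun x => 'X - x%:P)).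
move=> /real_eigenvalues_perm[/perm_map_preimage[L pL eL] sL].
exists U, d, L; split => //; split.
- by rewrite (perm_uniq pL) index_enum_uniq.
- by rewrite (perm_size pL) -[RHS]card_ord cardT enumT.
- by rewrite -eL.
- by rewrite /sum_smallest_eigenvalues eL -map_take big_map.
Qed.

Lemma sum_smallest_attained : exists Q B : 'M[R]_n,
  [/\ Q = Q *m Q^T + B *m B^T, \tr Q = k%:R &
    \tr (M *m Q) = sum_smallest_eigenvalues k M].
Proof.
have [U [d [L [UU UU' ME [uL sL _ ->]]]]] := sym_spectral_sorted.
have [Q [B [HQ trQ trMQ]]] := real_part_projection [set i in take k L] UU UU' ME.
exists Q, B; split=> //.
  rewrite trQ cardsE; have /card_uniqP -> := take_uniq k uL.
  by rewrite size_take sL; case: ltngtP k_le_n => // ->.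
rewrite trMQ big_uniq ?take_uniq //; apply: eq_bigl => i.
by rewrite inE.
Qed.

Lemma sum_smallest_le_trace (Q : 'M[R]_n) : Q^T = Q -> Q *m Q = Q -> \tr Q = k%:R ->
  sum_smallest_eigenvalues k M <= \tr (M *m Q).
Proof.
move=> symQ QQ trQ.
have [U [d [L [UU UU' ME [uL sL soL ->]]]]] := sym_spectral_sorted.
have [q q01 [sumq ->]] := trace_projection_spectral UU UU' ME symQ QQ.
have [theta Hth] := take_sorted_le soL uL sL.
rewrite big_uniq ?take_uniq //= -subr_ge0.
have -> : \sum_i d 0 i * q i - \sum_(i in take k L) d 0 i =
  \sum_i (d 0 i - theta) * (q i - (i \in take k L)%:R).
  have -> : \sum_(i in take k L) d 0 i = \sum_i d 0 i * (i \in take k L)%:R.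
    by rewrite big_mkcond; apply: eq_bigr => i _; case: ifP => _; rewrite ?mulr1 ?mulr0.
  under [in RHS]eq_bigr do rewrite mulrBl mulrBr.
  rewrite !sumrB -!mulr_sumr sumrB sumq trQ.
  have -> : \sum_i (i \in take k L)%:R = k%:R :> R.
    transitivity (\sum_(i in take k L) (1 : R)).
      by rewrite [RHS]big_mkcond; apply: eq_bigr => i _; case: (i \in _).
    rewrite sumr_const; have /card_uniqP -> := take_uniq k uL.
    by rewrite size_take sL; case: ltngtP k_le_n => // ->.
  by rewrite subrr mulr0 subr0.
apply: sumr_ge0 => i _; have := Hth i; have /andP[] := q01 i.
case: ifP => _ /= ? ? ?; last by rewrite subr0 mulr_ge0 // subr_ge0.
by rewrite mulr_le0 // subr_le0.
Qed.
End KyFan.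

(** * Multiplicative weights and the spectral embedding *)

Section ExpBounds.
Variable R : realType.
Implicit Types x : R.

Lemma expR_le_quadratic x : x <= 2^-1 -> expR x <= 1 + x + 2 * x ^+ 2.
Proof.
move=> x2; have := expR_ge1Dx (- x); have := expR_gt0 x; rewrite expRN.
move: (expR x) => y y0 H.
have yx : y * (1 - x) <= 1 by rewrite -[leRHS](divff (lt0r_neq0 y0)) ler_pM2l.
rewrite -(@ler_pM2r _ (1 - x)); last lra.
apply: le_trans yx _.
have -> : (1 + x + 2 * x ^+ 2) * (1 - x) = 1 + x ^+ 2 * (1 - 2 * x) by ring.
by rewrite lerDl mulr_ge0 ?sqr_ge0 //; lra.
Qed.
End ExpBounds.

Section Hedge.
Variables (R : realType) (J O : finType) (E : {set J}) (A : J -> {set O}) (w : J -> R).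
Hypothesis w_ge0 : forall e, e \in E -> 0 <= w e.
Variables (Y : (O -> R) -> Prop) (B sigma : R).
Hypothesis B_gt0 : 0 < B.
Hypothesis Y_bound : forall y, Y y -> forall p, 0 <= y p <= B.
Hypothesis oracle : forall c : O -> J -> R,
  (forall e, e \in E -> (forall p, p \in A e -> 0 <= c p e) /\ \sum_(p in A e) c p e <= w e) ->
  exists2 y, Y y & \sum_(e in E) \sum_(p in A e) c p e * y p <= sigma.

Let gain (T : nat) (ys : nat -> O -> R) p := \sum_(i < T) ys i p.
Let Z eta T ys e := \sum_(p in A e) expR (eta * gain T ys p).

(* Multiplicative weights: the oracle answers the weights proportional to the exponentials of
   the accumulated gains, and [ln Z] is the usual potential. *)
Lemma hedge_potential (eta : R) (T : nat) : 0 < eta -> eta * B <= 2^-1 ->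
  exists2 ys, (forall i, (i < T)%N -> Y (ys i)) &
    \sum_(e in E) w e * ln (Z eta T ys e) <=
      \sum_(e in E) w e * ln #|A e|%:R
      + T%:R * (eta * sigma + 2 * (eta * B) ^+ 2 * \sum_(e in E) w e).
Proof.
move=> eta0 etaB; elim: T => [|T [ys Yys IH]].
  exists (fun _ _ => 0) => //; rewrite mul0r addr0.
  apply/ler_sum => e eE; apply: ler_wpM2l; first exact: w_ge0.
  rewrite /Z; under eq_bigr do rewrite /gain big_ord0 mulr0 expR0.
  by rewrite sumr_const.
have Zgt0 e p : p \in A e -> 0 < Z eta T ys e.
  move=> pA; rewrite /Z (bigD1 p) //= ltr_pwDl ?expR_gt0 // sumr_ge0 // => *.
  exact: expR_ge0.
pose q p e := expR (eta * gain T ys p) / Z eta T ys e.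
have [y Yy ysig] : exists2 y, Y y &
    \sum_(e in E) \sum_(p in A e) (w e * q p e) * y p <= sigma.
  apply: oracle => e eE; split.
    move=> p pA; rewrite mulr_ge0 ?w_ge0 // divr_ge0 ?expR_ge0 //.
    by rewrite ltW // (Zgt0 _ _ pA).
  rewrite -mulr_sumr -mulr_suml -/(Z eta T ys e).
  have [-> |Z0] := eqVneq (Z eta T ys e) 0; first by rewrite mul0r mulr0 w_ge0.
  by rewrite divff // mulr1.
pose ys' i := if (i < T)%N then ys i else y.
exists ys' => [i|].
  by rewrite /ys'; case: ifP => [/Yys|].
have gainE p : gain T.+1 ys' p = gain T ys p + y p.
  rewrite /gain big_ord_recr /= /ys' ltnn; congr (_ + _).
  by apply: eq_bigr => i _; rewrite ltn_ord.
have step e : e \in E -> w e * ln (Z eta T.+1 ys' e) <= w e * ln (Z eta T ys e)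
    + eta * (\sum_(p in A e) (w e * q p e) * y p) + 2 * (eta * B) ^+ 2 * w e.
  move=> eE; have we := w_ge0 eE.
  have [A0|[p0 p0A]] := set_0Vmem (A e).
    rewrite /Z A0 !big_set0 ln0 // !mulr0 !add0r.
    by rewrite mulr_ge0 // mulr_ge0 // sqr_ge0.
  have Z0 := Zgt0 _ _ p0A.
  have Z'E : Z eta T.+1 ys' e <= Z eta T ys e *
      (1 + (eta * \sum_(p in A e) q p e * y p + 2 * (eta * B) ^+ 2)).
    have qsum : \sum_(p in A e) q p e = 1.
      by rewrite -mulr_suml -/(Z eta T ys e) divff // gt_eqF.
    have -> : 1 + (eta * \sum_(p in A e) q p e * y p + 2 * (eta * B) ^+ 2) =
       \sum_(p in A e) q p e * (1 + eta * y p + 2 * (eta * B) ^+ 2).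
      under [in RHS]eq_bigr do rewrite !mulrDr mulr1.
      rewrite !big_split /= qsum -mulr_suml qsum mul1r mulr_sumr addrA.
      by congr (_ + _ + _); apply: eq_bigr => p _; rewrite mulrCA.
    rewrite mulr_sumr; apply: ler_sum => p pA.
    rewrite gainE mulrDr expRD mulrA /q mulrCA mulfV ?gt_eqF // mulr1.
    apply: ler_wpM2l; first exact: expR_ge0.
    have /andP[yp0 ypB] := Y_bound Yy p.
    have yB : eta * y p <= eta * B by rewrite ler_pM2l.
    apply: le_trans (expR_le_quadratic (le_trans yB etaB)) _.
    rewrite lerD2l ler_pM2l //.
    by rewrite ler_sqr // nnegrE mulr_ge0 // ltW.
  have -> : w e * ln (Z eta T ys e) + eta * (\sum_(p in A e) (w e * q p e) * y p)
    + 2 * (eta * B) ^+ 2 * w e = w e * (ln (Z eta T ys e) +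
      (eta * \sum_(p in A e) q p e * y p + 2 * (eta * B) ^+ 2)).
    under eq_bigr do rewrite -mulrA.
    by rewrite -mulr_sumr; ring.
  apply: ler_wpM2l => //.
  set x := eta * _ + _ in Z'E *.
  have x0 : 0 <= x.
    rewrite addr_ge0 //; last by rewrite mulr_ge0 ?sqr_ge0.
    rewrite mulr_ge0 ?(ltW eta0) // sumr_ge0 // => p pA.
    have /andP[yp0 _] := Y_bound Yy p.
    by rewrite mulr_ge0 // divr_ge0 ?expR_ge0 ?(ltW Z0).
  have Z'0 : 0 < Z eta T.+1 ys' e.
    rewrite /Z (bigD1 p0) //= ltr_pwDl ?expR_gt0 // sumr_ge0 // => *.
    exact: expR_ge0.
  apply: (@le_trans _ _ (ln (Z eta T ys e * (1 + x)))).
    by rewrite ler_ln ?posrE // mulr_gt0 //; lra.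
  rewrite lnM ?posrE //; last lra.
  by rewrite lerD2l le_ln1Dx //; lra.
apply: (le_trans (ler_sum _ (fun e eE => step e eE))).
rewrite !big_split /= -!mulr_sumr -natr1 mulrDl mul1r.
have := ler_wpM2l (ltW eta0) ysig; move: IH; lra.
Qed.

Lemma hedge (delta : R) : 0 < delta ->
  exists (T : nat) (ys : nat -> O -> R) (D : J -> R), [/\ (0 < T)%N,
    forall i, (i < T)%N -> Y (ys i),
    forall e, e \in E -> 0 <= D e,
    forall e p, e \in E -> p \in A e -> T%:R^-1 * \sum_(i < T) ys i p <= D e &
    \sum_(e in E) w e * D e <= sigma + delta].
Proof.
move=> delta0.
pose W := \sum_(e in E) w e; pose K := \sum_(e in E) w e * ln #|A e|%:R.
have W0 : 0 <= W by apply: sumr_ge0 => e /w_ge0.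
pose eta := Num.min (2 * B)^-1 (delta / (4 * B ^+ 2 * (W + 1))).
have eta0 : 0 < eta.
  by rewrite lt_min invr_gt0 divr_gt0 // !mulr_gt0 ?exprn_gt0 //; lra.
have etaB : eta * B <= 2^-1.
  by rewrite -ler_pdivlMr // -invfM ge_min lexx.
have etaW : 2 * eta * B ^+ 2 * W <= delta / 2.
  have : eta <= delta / (4 * B ^+ 2 * (W + 1)) by rewrite ge_min lexx orbT.
  rewrite ler_pdivlMr; last by rewrite !mulr_gt0 ?exprn_gt0 //; lra.
  have := mulr_gt0 eta0 (exprn_gt0 2 B_gt0); set x := B ^+ 2; nra.
pose T := (Num.truncn (2 * `|K| / (eta * delta))).+1.
have T0 : 0 < T%:R :> R by rewrite ltr0n.
have KT : K / (eta * T%:R) <= delta / 2.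
  rewrite ler_pdivrMr ?mulr_gt0 //.
  have : 2 * `|K| / (eta * delta) < T%:R by apply: truncnS_gt.
  rewrite ltr_pdivrMr ?mulr_gt0 // => H; have := ler_norm K; lra.
have [ys Yys H] := hedge_potential T eta0 etaB.
exists T, ys, (fun e => (eta * T%:R)^-1 * ln (Z eta T ys e)); split => //.
- move=> e eE; rewrite mulr_ge0 ?invr_ge0 ?mulr_ge0 ?(ltW eta0) //.
  have [A0|[p pA]] := set_0Vmem (A e); first by rewrite /Z A0 big_set0 ln0.
  rewrite ln_ge0 // /Z (bigD1 p) //= -[leLHS]addr0 lerD //; last first.
    by apply: sumr_ge0 => *; apply: expR_ge0.
  rewrite -expR0 ler_expR mulr_ge0 ?(ltW eta0) // sumr_ge0 // => i _.
  by have /andP[] := Y_bound (Yys i (ltn_ord i)) p.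
- move=> e p eE pA; rewrite invfM [_^-1 * _^-1]mulrC -mulrA.
  rewrite ler_pM2l ?invr_gt0 // -(ler_pM2l eta0) mulrA mulfV ?gt_eqF // mul1r.
  rewrite -[leLHS]expRK ler_ln ?posrE ?expR_gt0 //; last first.
    rewrite /Z (bigD1 p) //= ltr_pwDl ?expR_gt0 // sumr_ge0 // => *.
    exact: expR_ge0.
  rewrite /Z (bigD1 p) //= -[leLHS]addr0 lerD //.
  by apply: sumr_ge0 => *; apply: expR_ge0.
- under eq_bigr do rewrite mulrCA.
  rewrite -mulr_sumr; apply: (@le_trans _ _ ((eta * T%:R)^-1 *
    (K + T%:R * (eta * sigma + 2 * (eta * B) ^+ 2 * W)))).
    by rewrite ler_wpM2l // invr_ge0 mulr_ge0 ?(ltW eta0).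
  have -> : (eta * T%:R)^-1 * (K + T%:R * (eta * sigma + 2 * (eta * B) ^+ 2 * W)) =
    K / (eta * T%:R) + sigma + 2 * eta * B ^+ 2 * W.
    by field; rewrite !gt_eqF.
  lra.
Qed.
End Hedge.

Section Embedding.
Variables (R : realType) (V : finType).

Definition dotp (I : finType) (f : V -> I -> R) u v := \sum_i f u i * f v i.
Definition sqdist (I : finType) (f : V -> I -> R) u v := \sum_i (f u i - f v i) ^+ 2.

Definition pair_energy (I : finType) (f : V -> I -> R) (p : {set V}) :=
  2^-1 * \sum_(u in p) \sum_(v in p) sqdist f u v.

Lemma sqdistE (I : finType) (f : V -> I -> R) u v : sqdist f u v = dotp f u u + dotp f v v - 2 * dotp f u v.
Proof.
rewrite /sqdist /dotp mulr_sumr -big_split -sumrB /=.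
by apply: eq_bigr => i _; ring.
Qed.

Lemma sqdist_ge0 (I : finType) (f : V -> I -> R) u v : 0 <= sqdist f u v.
Proof. by apply: sumr_ge0 => i _; apply: sqr_ge0. Qed.

Lemma sqdistxx (I : finType) (f : V -> I -> R) u : sqdist f u u = 0.
Proof. by rewrite /sqdist big1 // => i _; rewrite subrr expr0n. Qed.

Lemma sqdistC (I : finType) (f : V -> I -> R) u v : sqdist f u v = sqdist f v u.
Proof. by apply: eq_bigr => i _; rewrite -sqrrN opprB. Qed.

Lemma dotpC (I : finType) (f : V -> I -> R) u v : dotp f u v = dotp f v u.
Proof. by apply: eq_bigr => i _; rewrite mulrC. Qed.

Lemma pair_energy2 (I : finType) (f : V -> I -> R) u v : u != v -> pair_energy f [set u; v] = sqdist f u v.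
Proof.
move=> uv; rewrite /pair_energy !big_setU1 ?inE //= !big_set1 !big_setU1 ?inE //= !big_set1.
by rewrite !sqdistxx (sqdistC f v u); lra.
Qed.

Lemma pair_energy_ge0 (I : finType) (f : V -> I -> R) p : 0 <= pair_energy f p.
Proof. by rewrite mulr_ge0 ?invr_ge0 // !sumr_ge0 // => u _; rewrite sumr_ge0 // => *; apply: sqdist_ge0. Qed.

Lemma sum_ordered_pairs (K : {set V} -> R) (s : V -> V -> R) :
  (forall u, s u u = 0) ->
  \sum_u \sum_(v | u != v) K [set u; v] * s u v =
  \sum_(p : {set V} | #|p| == 2%N) K p * \sum_(u in p) \sum_(v in p) s u v.
Proof.
move=> s0; rewrite pair_big_dep /=.
rewrite (partition_big (fun x : V * V => [set x.1; x.2]) (fun p => #|p| == 2%N)) /=; last first.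
  by case=> u v /= uv; rewrite cards2 uv.
apply: eq_bigr => p /cards2P[a [b [ab ->]]].
rewrite (eq_bigr (fun x => K [set a; b] * s x.1 x.2)); last first.
  by move=> x /andP[_ /eqP->].
rewrite -mulr_sumr; congr (_ * _).
rewrite pair_big_dep /= [RHS](bigID (fun x : V * V => x.1 == x.2)) /= [X in _ = X + _]big1 ?add0r; last first.
  by case=> u v /= /andP[_ /eqP->].
apply: eq_bigl => -[u v] /=; rewrite [RHS]andbC.
case: eqVneq => //= uv. rewrite !inE; apply/idP/idP => [/eqP E|/andP[]].
  by have := set21 u v; have := set22 u v; rewrite E !inE => -> ->.
by move=> /orP[]/eqP Eu /orP[]/eqP Ev; move: uv; rewrite Eu Ev ?eqxx // => _; rewrite finset.setUC.
Qed.

Variables (E : {set {set V}}) (w : {set V} -> R).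
Implicit Types c : {set V} -> {set V} -> R.

Lemma radjC c u v : radj E c u v = radj E c v u.
Proof. by rewrite /radj eq_sym finset.setUC. Qed.

Lemma nlaplacian_sym c : (nlaplacian E w c)^T = nlaplacian E w c.
Proof.
rewrite /nlaplacian !trmx_mul !tr_diag_mx -mulmxA; congr (_ *m (_ *m _)).
rewrite linearB /= tr_diag_mx; congr (_ - _).
by apply/matrixP => i j; rewrite !mxE radjC.
Qed.

Lemma sum_radj c (s : V -> V -> R) : (forall u, s u u = 0) ->
  \sum_u \sum_v radj E c u v * s u v =
  \sum_(e in E) \sum_(p in pairs_in e) c p e * \sum_(u in p) \sum_(v in p) s u v.
Proof.
move=> s0.
transitivity (\sum_u \sum_(v | u != v) (\sum_(e in E | [set u; v] \subset e) c [set u; v] e) * s u v).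
  apply: eq_bigr => u _; rewrite [in RHS]big_mkcond; apply: eq_bigr => v _.
  by rewrite /radj; case: eqVneq => [->|_] //=; rewrite s0 mulr0.
rewrite (sum_ordered_pairs (fun p => \sum_(e in E | p \subset e) c p e)) //.
under eq_bigr do rewrite mulr_suml.
rewrite (exchange_big_dep (fun e => e \in E)) /=; last by move=> p e _ /andP[].
apply: eq_bigr => e eE; apply: eq_bigl => p.
by rewrite inE eE.
Qed.

Lemma trace_nlaplacian c m (F : 'M[R]_(#|V|, m)) :
  \tr (nlaplacian E w c *m (F *m F^T)) = \sum_(e in E) \sum_(p in pairs_in e)
    c p e * pair_energy (fun v (j : 'I_m) => (Num.sqrt (wdeg E w v))^-1 * F (enum_rank v) j) p.
Proof.
pose f (v : V) (j : 'I_m) := (Num.sqrt (wdeg E w v))^-1 * F (enum_rank v) j; rewrite -/f.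
set N := wdeg_invsqrt_mx E w; set L := rdeg_mx E c - radj_mx E c.
have NT : N^T = N by rewrite tr_diag_mx.
have -> : \tr (nlaplacian E w c *m (F *m F^T)) = \tr (L *m ((N *m F) *m (N *m F)^T)).
  rewrite trmx_mul NT /nlaplacian -/N -/L -!mulmxA mxtrace_mulC.
  by rewrite -!mulmxA.
have GE : (N *m F) *m (N *m F)^T = \matrix_(i, l) dotp f (enum_val i) (enum_val l).
  apply/matrixP => i l; rewrite !mxE; apply: eq_bigr => j _.
  by rewrite [X in _ * X]mxE /N /wdeg_invsqrt_mx mul_diag_mx !mxE /f !enum_valK.
rewrite GE /mxtrace.
transitivity (\sum_u \sum_v ((u == v)%:R * (\sum_x radj E c x u) - radj E c u v) * dotp f v u).
  rewrite [RHS](reindex (@enum_val V V)) /=; last exact: onW_bij (enum_val_bij V).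
  apply: eq_bigr => i _; rewrite mxE [RHS](reindex (@enum_val V V)) /=; last exact: onW_bij (enum_val_bij V).
  apply: eq_bigr => j _; rewrite !mxE (inj_eq enum_val_inj).
  by case: eqP => _; rewrite ?mulr1n ?mulr0n ?mul1r ?mul0r.
transitivity (\sum_u \sum_v radj E c u v * (dotp f u u - dotp f u v)).
  apply: eq_bigr => u _; under eq_bigr do rewrite mulrBl.
  under [RHS]eq_bigr do rewrite mulrBr.
  rewrite !sumrB (bigD1 u) //= eqxx mul1r [X in _ + X - _ = _]big1 ?addr0; last first.
    by move=> v vu; rewrite eq_sym (negPf vu) !mul0r.
  rewrite mulr_suml; congr (_ - _); apply: eq_bigr => v _; first by rewrite radjC.
  by rewrite dotpC.
transitivity (2^-1 * \sum_u \sum_v radj E c u v * sqdist f u v).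
  have -> : \sum_u \sum_v radj E c u v * sqdist f u v =
    \sum_u \sum_v radj E c u v * (dotp f u u - dotp f u v) +
    \sum_u \sum_v radj E c u v * (dotp f v v - dotp f u v).
    rewrite -big_split; apply: eq_bigr => u _; rewrite -big_split; apply: eq_bigr => v _ /=.
    by rewrite sqdistE; ring.
  rewrite [X in 2^-1 * (_ + X)]exchange_big /=.
  have -> : \sum_u \sum_v radj E c v u * (dotp f u u - dotp f v u) =
    \sum_u \sum_v radj E c u v * (dotp f u u - dotp f u v).
    by apply: eq_bigr => u _; apply: eq_bigr => v _; rewrite radjC dotpC.
  lra.
rewrite sum_radj; last by move=> u; apply: sqdistxx.
rewrite mulr_sumr; apply: eq_bigr => e _; rewrite mulr_sumr; apply: eq_bigr => p _.
by rewrite mulrCA.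
Qed.
End Embedding.

Section CauchySchwarz.
Variables (R : realFieldType) (I : finType).

Lemma sum_cauchy_schwarz (P : pred I) (a b : I -> R) :
  (\sum_(i | P i) a i * b i) ^+ 2 <= (\sum_(i | P i) a i ^+ 2) * (\sum_(i | P i) b i ^+ 2).
Proof.
rewrite -subr_ge0.
have -> : (\sum_(i | P i) a i ^+ 2) * (\sum_(i | P i) b i ^+ 2) - (\sum_(i | P i) a i * b i) ^+ 2 =
  2^-1 * \sum_(i | P i) \sum_(j | P j) (a i * b j - a j * b i) ^+ 2.
  have -> : \sum_(i | P i) \sum_(j | P j) (a i * b j - a j * b i) ^+ 2 =
    (\sum_(i | P i) \sum_(j | P j) a i ^+ 2 * b j ^+ 2) +
    (\sum_(i | P i) \sum_(j | P j) a j ^+ 2 * b i ^+ 2) -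
    2 * (\sum_(i | P i) \sum_(j | P j) (a i * b i) * (a j * b j)).
    rewrite mulr_sumr -big_split -sumrB /=; apply: eq_bigr => i _.
    rewrite mulr_sumr -big_split -sumrB /=; apply: eq_bigr => j _; ring.
  by rewrite [X in _ + X - _]exchange_big /= -!big_distrlr /=; field.
by rewrite mulr_ge0 ?invr_ge0 // !sumr_ge0 // => i _; rewrite sumr_ge0 // => *; apply: sqr_ge0.
Qed.

Lemma sqr_sum_le (P : pred I) (a : I -> R) :
  (\sum_(i | P i) a i) ^+ 2 <= #|P|%:R * \sum_(i | P i) a i ^+ 2.
Proof.
have := sum_cauchy_schwarz P (fun=> 1) a.
under eq_bigr do rewrite mul1r.
by under [X in _ <= X * _]eq_bigr do rewrite expr1n; rewrite sumr_const.
Qed.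
End CauchySchwarz.

Section Isotropic.
Variables (R : realType) (V : finType) (d : V -> R).
Hypothesis d_gt0 : forall v, 0 < d v.

(* The second clause follows from [\sum_v d v f(v) f(v)^T <= Id]. *)
Definition sub_isotropic (I : finType) (k : R) (f : V -> I -> R) :=
  \sum_v d v * dotp f v v = k /\ forall u, \sum_v d v * dotp f u v ^+ 2 <= dotp f u u.

Lemma sub_isotropic_average (J I : finType) k (f : J -> V -> I -> R) : (0 < #|J|)%N ->
  (forall j, sub_isotropic k (f j)) ->
  sub_isotropic k (fun v (x : J * I) => (Num.sqrt #|J|%:R)^-1 * f x.1 v x.2).
Proof.
move=> J0 fiso; have J0' : 0 < #|J|%:R :> R by rewrite ltr0n.
pose g (v : V) (x : J * I) := (Num.sqrt #|J|%:R)^-1 * f x.1 v x.2; rewrite -/g.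
have dotgE u v : dotp g u v = #|J|%:R^-1 * \sum_j dotp (f j) u v.
  rewrite /dotp /g -(pair_bigA _ (fun j i => ((Num.sqrt #|J|%:R)^-1 * f j u i) * ((Num.sqrt #|J|%:R)^-1 * f j v i))) /=.
  rewrite mulr_sumr; apply: eq_bigr => j _; rewrite mulr_sumr; apply: eq_bigr => i _.
  by rewrite mulrACA -invfM -expr2 sqr_sqrtr ?ltW.
split.
  under eq_bigr do rewrite dotgE mulrCA mulr_sumr.
  rewrite -mulr_sumr exchange_big /=.
  under eq_bigr do rewrite (fiso _).1.
  by rewrite sumr_const -[k *+ _]mulr_natl mulrA mulVf ?mul1r // gt_eqF.
move=> u; rewrite dotgE.
apply: (@le_trans _ _ (\sum_v d v * (#|J|%:R^-1 * \sum_j dotp (f j) u v ^+ 2))).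
  apply: ler_sum => v _; rewrite ler_pM2l // dotgE exprMn expr2 -mulrA ler_pM2l ?invr_gt0 //.
  by rewrite mulrC ler_pdivrMr // mulrC sqr_sum_le.
under eq_bigr do rewrite mulrCA mulr_sumr.
rewrite -mulr_sumr exchange_big /= ler_pM2l ?invr_gt0 //.
by apply: ler_sum => j _; apply: (fiso j).2.
Qed.

Lemma sub_isotropic_projection m k (Q B : 'M[R]_#|V|) (F : 'M[R]_(#|V|, m)) :
  Q = Q *m Q^T + B *m B^T -> Q = F *m F^T -> \tr Q = k ->
  sub_isotropic k (fun v j => (Num.sqrt (d v))^-1 * F (enum_rank v) j).
Proof.
move=> QB QF trQ; pose f (v : V) (j : 'I_m) := (Num.sqrt (d v))^-1 * F (enum_rank v) j; rewrite -/f.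
have dotE u v : dotp f u v = (Num.sqrt (d u))^-1 * (Num.sqrt (d v))^-1 * Q (enum_rank u) (enum_rank v).
  by rewrite QF !mxE mulr_sumr; apply: eq_bigr => j _; rewrite !mxE /f mulrACA.
have sq v : (Num.sqrt (d v))^-1 ^+ 2 = (d v)^-1 by rewrite exprVn sqr_sqrtr // ltW.
split.
  rewrite -trQ /mxtrace [RHS](reindex (@enum_rank V)) /=; last exact: onW_bij (enum_rank_bij V).
  by apply: eq_bigr => v _; rewrite dotE -expr2 sq mulrA mulfV ?mul1r // gt_eqF.
move=> u; rewrite [leRHS]dotE -expr2 sq.
under eq_bigr => v _ do rewrite dotE !exprMn !sq [_ * (d v)^-1]mulrC -mulrA mulVKf ?gt_eqF //.
rewrite -mulr_sumr ler_pM2l ?invr_gt0 //.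
rewrite [in leRHS]QB !mxE.
have symQ i j : Q i j = Q j i.
  by rewrite QF !mxE; apply: eq_bigr => l _; rewrite !mxE mulrC.
rewrite [X in _ <= X + _](reindex (@enum_rank V)) /=; last exact: onW_bij (enum_rank_bij V).
apply: ler_wpDr; first by apply: sumr_ge0 => j _; rewrite mxE -expr2 sqr_ge0.
by apply: ler_sum => v _; rewrite mxE expr2.
Qed.
End Isotropic.

Section SpectralEmbedding.
Variables (R : realType) (V : finType) (E : {set {set V}}) (w : {set V} -> R) (k : nat) (sigma : R).
Hypothesis w_ge0 : forall e, e \in E -> 0 <= w e.
Hypothesis wdeg_gt0 : forall v, 0 < wdeg E w v.
Hypothesis k_le_V : (k <= #|V|)%N.
Hypothesis sigma_ub : forall c, feasible E w c ->
  sum_smallest_eigenvalues k (nlaplacian E w c) <= sigma.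

Lemma dotp_ge0 (I : finType) (f : V -> I -> R) u : 0 <= dotp f u u.
Proof. by apply: sumr_ge0 => i _; rewrite -expr2 sqr_ge0. Qed.

Lemma sqdist_le (I : finType) (f : V -> I -> R) u v : sqdist f u v <= 2 * (dotp f u u + dotp f v v).
Proof.
rewrite /sqdist /dotp -big_split mulr_sumr; apply: ler_sum => i _ /=.
by have := sqr_ge0 (f u i + f v i); nra.
Qed.

Lemma spectral_embedding (delta : R) : 0 < delta ->
  exists (I : finType) (f : V -> I -> R) (D : {set V} -> R),
    [/\ sub_isotropic (wdeg E w) k%:R f,
      forall e, e \in E -> 0 <= D e,
      forall e u v, e \in E -> u \in e -> v \in e -> sqdist f u v <= D e &
      \sum_(e in E) w e * D e <= sigma + delta].
Proof.
move=> delta0.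
pose m := (#|V| + #|V|)%N.
pose emb (F : 'M[R]_(#|V|, m)) v (j : 'I_m) := (Num.sqrt (wdeg E w v))^-1 * F (enum_rank v) j.
pose Y y := exists2 F, sub_isotropic (wdeg E w) k%:R (emb F) & y = pair_energy (emb F).
pose B : R := 1 + 2 * #|V|%:R * \sum_v k%:R / wdeg E w v.
have sum0 : 0 <= \sum_v k%:R / wdeg E w v by apply: sumr_ge0 => v _; rewrite divr_ge0 // ltW.
have B0 : 0 < B by rewrite ltr_pwDl // mulr_ge0 // mulr_ge0.
have Y_bound y : Y y -> forall p, 0 <= y p <= B.
  move=> [F [Fk _] ->] p; rewrite pair_energy_ge0 /=.
  have dF v : dotp (emb F) v v <= k%:R / wdeg E w v.
    rewrite ler_pdivlMr // mulrC -Fk (bigD1 v) //= lerDl sumr_ge0 // => u _.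
    by rewrite mulr_ge0 ?dotp_ge0 // ltW.
  have -> : B = 2^-1 * (2 + \sum_(u : V) \sum_(v : V) 2 * (k%:R / wdeg E w u + k%:R / wdeg E w v)).
    pose a v := k%:R / wdeg E w v; rewrite /B -/(a _).
    have -> : \sum_(u : V) \sum_(v : V) 2 * (a u + a v) = 4 * #|V|%:R * \sum_v a v.
      under eq_bigr => u _ do rewrite -mulr_sumr big_split /= sumr_const.
      rewrite -mulr_sumr big_split /= sumr_const sumrMnl -mulr_natl.
      by rewrite -[X in _ * (_ + X)]mulr_natl; ring.
    by field.
  rewrite /pair_energy ler_pM2l ?invr_gt0 //; apply: ler_wpDl => //.
  have pos u v : 0 <= 2 * (k%:R / wdeg E w u + k%:R / wdeg E w v).
    by rewrite mulr_ge0 // addr_ge0 // divr_ge0 // ltW.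
  rewrite big_mkcond; apply: ler_sum => u _; case: ifP => _; last by rewrite sumr_ge0.
  rewrite big_mkcond; apply: ler_sum => v _; case: ifP => // _.
  by apply: le_trans (sqdist_le _ _ _) _; rewrite ler_pM2l // lerD.
have oracle c : feasible E w c ->
    exists2 y, Y y & \sum_(e in E) \sum_(p in pairs_in e) c p e * y p <= sigma.
  move=> /sigma_ub Hc.
  have [Q [B' [QB trQ trM]]] := sum_smallest_attained (nlaplacian_sym E w c) k_le_V.
  have QF : Q = row_mx Q B' *m (row_mx Q B')^T by rewrite tr_row_mx mul_row_col.
  exists (pair_energy (emb (row_mx Q B'))).
    exists (row_mx Q B') => //; exact: sub_isotropic_projection QB QF trQ.
  by rewrite -trace_nlaplacian -QF trM.
have [T [ys [D [T0 Yys D0 HD sumD]]]] := hedge w_ge0 B0 Y_bound oracle delta0.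
have /boolp.choice[F HF] : forall i : 'I_T, exists F, sub_isotropic (wdeg E w) k%:R (emb F) /\ ys i = pair_energy (emb F).
  by move=> i; have [F ? ?] := Yys i (ltn_ord i); exists F.
exists ('I_T * 'I_m)%type, (fun v x => (Num.sqrt #|'I_T|%:R)^-1 * emb (F x.1) v x.2), D; split => //.
  by apply: (sub_isotropic_average wdeg_gt0 (f := fun i => emb (F i))) => [|j]; [rewrite card_ord | exact: (HF j).1].
move=> e u v eE ue ve.
have [->|uv] := eqVneq u v; first by rewrite sqdistxx D0.
apply: le_trans (HD e [set u; v] eE _); last first.
  by rewrite inE cards2 uv /=; apply/fintype.subsetP => x; rewrite !inE => /orP[]/eqP->.
rewrite /sqdist -(pair_bigA _ (fun i j => ((Num.sqrt #|'I_T|%:R)^-1 * emb (F i) u j - (Num.sqrt #|'I_T|%:R)^-1 * emb (F i) v j) ^+ 2)) /=.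
rewrite mulr_sumr; apply: ler_sum => i _; rewrite (HF i).2 pair_energy2 // /sqdist mulr_sumr.
apply: ler_sum => j _; rewrite -mulrBr exprMn exprVn sqr_sqrtr // card_ord //.
Qed.
End SpectralEmbedding.

(** * Random cuts *)

Section Rademacher.
Variables (R : realType) (I : finType).
Implicit Types (x : I -> R) (s : {ffun I -> bool}).
Local Notation S := {ffun I -> bool}.

Definition rademacher x s : R := \sum_i (-1) ^+ s i * x i.

Let flip j s : S := [ffun i => if i == j then ~~ s i else s i].

Let flipK j : involutive (flip j).
Proof. by move=> s; apply/ffunP => i; rewrite !ffunE; case: eqP; rewrite ?negbK. Qed.

Let sum_flip_odd j (G : S -> R) : (forall s, G (flip j s) = G s) -> \sum_(s : S) (-1) ^+ s j * G s = 0.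
Proof.
move=> GE; have : \sum_(s : S) (-1) ^+ s j * G s = - \sum_(s : S) (-1) ^+ s j * G s.
  rewrite {1}(reindex (flip j)) /=; last exact: onW_bij (inv_bij (flipK j)).
  rewrite -sumrN; apply: eq_bigr => s _; rewrite GE ffunE eqxx.
  by case: (s j) => /=; rewrite ?expr0 ?expr1 ?mulN1r ?opprK ?mul1r.
by lra.
Qed.

Let partial (r : seq I) x s : R := \sum_(i <- r) (-1) ^+ s i * x i.

Let partial_flip (r : seq I) x j s : j \notin r -> partial r x (flip j s) = partial r x s.
Proof.
move=> jr; apply: eq_big_seq => i ir; rewrite ffunE; case: eqP => // ij.
by rewrite -ij ir in jr.
Qed.

Let partial_moments (r : seq I) x : uniq r ->
  \sum_s partial r x s ^+ 2 = #|S|%:R * \sum_(i <- r) x i ^+ 2 /\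
  \sum_s partial r x s ^+ 4 <= #|S|%:R * (3 * (\sum_(i <- r) x i ^+ 2) ^+ 2).
Proof.
elim: r => [_|j r IH /= /andP[jr ur]].
  rewrite !big_nil; split; first by rewrite big1 ?mulr0 // => s _; rewrite /partial big_nil expr0n.
  by rewrite big1 ?mulr0 ?expr0n ?mulr0 ?mulr0 // => s _; rewrite /partial big_nil expr0n.
have {IH}[IH2 IH4] := IH ur.
have pE s : partial (j :: r) x s = (-1) ^+ s j * x j + partial r x s by rewrite /partial big_cons.
have s2 (s : S) : ((-1) ^+ s j) ^+ 2 = 1 :> R by rewrite sqrr_sign.
have o1 : \sum_(s : S) (-1) ^+ s j * partial r x s = 0.
  by apply: sum_flip_odd => s; rewrite partial_flip.
have o3 : \sum_(s : S) (-1) ^+ s j * partial r x s ^+ 3 = 0.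
  by apply: (sum_flip_odd (G := fun s => partial r x s ^+ 3)) => s; rewrite partial_flip.
rewrite !big_cons; split.
  have -> : \sum_s partial (j :: r) x s ^+ 2 =
    \sum_(s : S) x j ^+ 2 + \sum_s partial r x s ^+ 2 + 2 * x j * \sum_(s : S) (-1) ^+ s j * partial r x s.
    rewrite mulr_sumr -!big_split; apply: eq_bigr => s _ /=; rewrite pE.
    move: ((-1) ^+ s j) (partial r x s) (x j) (s2 s) => a b c a2.
    by rewrite sqrrD exprMn a2; ring.
  by rewrite o1 IH2 sumr_const -[_ *+ _]mulr_natl; ring.
have -> : \sum_s partial (j :: r) x s ^+ 4 =
    \sum_(s : S) x j ^+ 4 + \sum_s partial r x s ^+ 4 + 6 * x j ^+ 2 * \sum_s partial r x s ^+ 2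
    + 4 * x j ^+ 3 * (\sum_(s : S) (-1) ^+ s j * partial r x s)
    + 4 * x j * \sum_(s : S) (-1) ^+ s j * partial r x s ^+ 3.
  rewrite !mulr_sumr -!big_split; apply: eq_bigr => s _ /=; rewrite pE.
  move: ((-1) ^+ s j) (partial r x s) (x j) (s2 s) => a b c a2.
  have -> : (a * c + b) ^+ 4 = a ^+ 2 * a ^+ 2 * c ^+ 4 + 4 * (a ^+ 2 * a) * c ^+ 3 * b
    + 6 * a ^+ 2 * c ^+ 2 * b ^+ 2 + 4 * a * c * b ^+ 3 + b ^+ 4 by ring.
  by rewrite a2; ring.
rewrite o1 o3 !mulr0 !addr0 IH2 sumr_const -[_ *+ _]mulr_natl.
set A := \sum_(i <- r) _ in IH4 *; have : 0 <= #|S|%:R :> R by [].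
have := sqr_ge0 (x j ^+ 2); rewrite -exprM; move: IH4; move: (#|S|%:R) (x j) => n y.
by move=> ? ? ?; nra.
Qed.

Lemma sum_rademacher2 x : \sum_s rademacher x s ^+ 2 = #|S|%:R * \sum_i x i ^+ 2.
Proof. exact: (partial_moments x (index_enum_uniq I)).1. Qed.

Lemma sum_rademacher4 x : \sum_s rademacher x s ^+ 4 <= #|S|%:R * (3 * (\sum_i x i ^+ 2) ^+ 2).
Proof. exact: (partial_moments x (index_enum_uniq I)).2. Qed.

(* Paley-Zygmund: [|t| N^3 >= t^2 N^2 - t^4/4], integrated against the second and fourth moments. *)
Lemma sum_rademacher1_ge x :
  #|S|%:R * (Num.sqrt (\sum_i x i ^+ 2) / 4) <= \sum_s `|rademacher x s|.
Proof.
set N := Num.sqrt _.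
have N2 : N ^+ 2 = \sum_i x i ^+ 2 by rewrite sqr_sqrtr // sumr_ge0 // => i _; rewrite sqr_ge0.
have [N0|N0] := eqVneq N 0; first by rewrite N0 mul0r mulr0 sumr_ge0.
have Np : 0 < N by rewrite lt_def N0 sqrtr_ge0.
have pt (t : R) : t ^+ 2 * N ^+ 2 - t ^+ 4 / 4 <= `|t| * N ^+ 3.
  rewrite -[4%N]/(2 * 2)%N exprM -(real_normK (num_real t)) -exprM.
  move: (normr_ge0 t); move: `|t| => a a0.
  have -> : a * N ^+ 3 = (a ^+ 2 * N ^+ 2 - a ^+ 4 / 4) + a * (N ^+ 3 - a * N ^+ 2 + a ^+ 3 / 4) by field.
  rewrite lerDl mulr_ge0 //.
  have -> : N ^+ 3 - a * N ^+ 2 + a ^+ 3 / 4 = (a - 7 / 6 * N) ^+ 2 * (a + 7 / 3 * N) / 4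
      + a * N ^+ 2 / 48 + 89 / 432 * N ^+ 3 by field.
  have := sqr_ge0 (a - 7 / 6 * N); have := exprn_gt0 3 Np; have := sqr_ge0 N.
  move: (_ ^+ 2) (N ^+ 3) ((a - _) ^+ 2) => N2' N3 q h1 h2 h3.
  have := mulr_ge0 a0 h1; have : 0 <= q * (a + 7 / 3 * N) by rewrite mulr_ge0 //; lra.
  lra.
have : \sum_s (rademacher x s ^+ 2 * N ^+ 2 - rademacher x s ^+ 4 / 4) <=
    \sum_s `|rademacher x s| * N ^+ 3 by apply: ler_sum => s _; apply: pt.
rewrite sumrB -!mulr_suml sum_rademacher2 => H.
have H4 := sum_rademacher4 x; rewrite -N2 -exprM in H H4 *.
have N3 : 0 < N ^+ 3 by apply: exprn_gt0.
rewrite -(ler_pM2r N3); apply: le_trans H.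
lra.
Qed.

Lemma expR_add_expRN_le (t : R) : expR t + expR (- t) <= 2 * expR (2 * t ^+ 2).
Proof.
wlog t0 : t / 0 <= t => [H|].
  have [/H//|t0] := lerP 0 t; have := H (- t); rewrite opprK sqrrN addrC; apply; lra.
have [t2|t2] := lerP t 2^-1.
  have h1 := expR_le_quadratic t2.
  have h2 : expR (- t) <= 1 + - t + 2 * (- t) ^+ 2 by apply: expR_le_quadratic; lra.
  have h3 := expR_ge1Dx (2 * t ^+ 2); rewrite sqrrN in h2; lra.
have h1 : expR t <= expR (2 * t ^+ 2) by rewrite ler_expR; nra.
have h2 : expR (- t) <= expR (2 * t ^+ 2) by rewrite ler_expR; nra.
lra.
Qed.

Lemma sum_expR_rademacher x : \sum_s expR (rademacher x s) <= #|S|%:R * expR (2 * \sum_i x i ^+ 2).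
Proof.
have -> : \sum_s expR (rademacher x s) = \prod_i \sum_(b : bool) expR ((-1) ^+ b * x i).
  by rewrite bigA_distr_bigA; apply: eq_bigr => s _; rewrite /rademacher expR_sum.
have -> : #|S|%:R * expR (2 * \sum_i x i ^+ 2) = \prod_i (2 * expR (2 * x i ^+ 2)).
  by rewrite big_split /= prodr_const card_ffun card_bool natrX mulr_sumr expR_sum.
apply: ler_prod => i _; rewrite big_bool /= expr0 expr1 mul1r mulN1r.
by rewrite addr_ge0 ?expR_ge0 //= addrC expR_add_expRN_le.
Qed.

End Rademacher.

Section Threshold.
Variables (R : realDomainType) (V : finType) (g : V -> R).

(* Discrete layer-cake: [om t] is the gap between [g t] and the next value of [g]. *)
Lemma threshold_weights : exists om : V -> R, (forall t, 0 <= om t) /\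
  forall u v, g u <= g v -> \sum_(t | g u <= g t < g v) om t = g v - g u.
Proof.
suff [om [om0 _ H]] : exists om : V -> R, [/\ (forall t, 0 <= om t),
    forall t, t \notin sort (relpre g <=%R) (enum V) -> om t = 0 &
    {in sort (relpre g <=%R) (enum V) &, forall u v, g u <= g v ->
      \sum_(t | g u <= g t < g v) om t = g v - g u}].
  by exists om; split=> // u v; apply: H; rewrite mem_sort mem_enum.
have := sort_sorted (fun x y => le_total (g x) (g y)) (enum V).
elim: (sort _ _) => [_|x s IH xs]; first by exists (fun=> 0); split.
have {IH}[om [om0 oms H]] := IH (path_sorted xs).
case: s => [|y s] in xs om om0 oms H *.
  exists (fun=> 0); split => // u v; rewrite !inE => /eqP-> /eqP-> _.
  by rewrite big1 // subrr.
have xy : g x <= g y by case/andP: xs.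
have yle t : t \in y :: s -> g y <= g t.
  rewrite inE => /orP[/eqP-> //|ts].
  have /= /andP[_ ys] := xs.
  have tr : transitive (relpre g <=%R) by move=> b a c; apply: le_trans.
  by have /allP/(_ t ts) := order_path_min tr ys.
exists (fun t => om t + (t == x)%:R * (g y - g x)); split.
- by move=> t; rewrite addr_ge0 ?om0 // mulr_ge0 // subr_ge0.
- by move=> t; rewrite inE negb_or => /andP[/negPf-> /oms->]; rewrite mul0r addr0.
move=> u v uxs vxs uv; rewrite big_split /=.
have -> : \sum_(t | (g u <= g t < g v)%R) (t == x)%:R * (g y - g x) =
    ((g u <= g x < g v)%R : nat)%:R * (g y - g x).
  rewrite big_mkcond (bigD1 x) //= eqxx mul1r [X in _ + X]big1 ?addr0.
    by case: ifP; rewrite ?mul1r ?mul0r.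
  by move=> t /negPf->; rewrite mul0r if_same.
have [vE|vx] := eqVneq v x.
  rewrite {}vE in vxs uv *.
  rewrite ltxx andbF mul0r addr0 big1 => [|t /andP[_ tx]].
    move: uxs uv; rewrite inE => /orP[/eqP->|/yle]; first by rewrite subrr.
    by move=> yu ux; apply/eqP; rewrite eq_sym subr_eq0 eq_le ux (le_trans xy yu).
  by apply: oms; apply: contraTN tx => /yle yt; rewrite -leNgt (le_trans xy yt).
have {}vxs : v \in y :: s by move: vxs; rewrite inE (negPf vx).
have yv := yle v vxs.
have [uE|ux] := eqVneq u x.
  rewrite {}uE in uxs uv *.
  rewrite lexx /= (eq_bigl (fun t => (g y <= g t < g v) || (g x <= g t < g v) && ~~ (g y <= g t))); last first.
    move=> t; case: (lerP (g y) (g t)) => [yt|_]; rewrite ?andbT ?andbF ?orbF //=.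
    by rewrite (le_trans xy yt).
  rewrite (bigID (fun t => g y <= g t)) /= [X in _ + X + _]big1 ?addr0; last first.
    move=> t /andP[_ yt]; apply: oms; apply: contra yt; exact: yle.
  rewrite (eq_bigl (fun t => g y <= g t < g v)); last first.
    by move=> t; case: (g y <= g t); rewrite ?andbF ?andbT ?orbF.
  rewrite H ?mem_head //; case: ltP => [_|vx']; first by rewrite mul1r; ring.
  have -> : g y = g x by apply/eqP; rewrite eq_le xy (le_trans yv vx').
  by rewrite mul0r addr0.
have {}uxs : u \in y :: s by move: uxs; rewrite inE (negPf ux).
have yu := yle u uxs.
rewrite H //; case: andP => [[ux' _]|_]; last by rewrite mul0r addr0.
have -> : g y = g x by apply/eqP; rewrite eq_le xy (le_trans yu ux').
by rewrite subrr mulr0 addr0.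
Qed.

Lemma threshold_weights_le (M : R) : 0 <= M -> (forall v, `|g v| <= M) ->
  exists om : V -> R, [/\ forall t, 0 <= om t, \sum_t om t <= 2 * M &
  forall u v, g u <= g v -> \sum_(t | g u <= g t < g v) om t = g v - g u].
Proof.
move=> M0 gM; have [om [om0 H]] := threshold_weights.
exists (fun t => if [exists v, g t < g v] then om t else 0); split.
- by move=> t; case: ifP.
- have [V0|] := set_0Vmem [set: V].
    by rewrite big1 ?mulr_ge0 // => t _; have := finset.in_setT t; rewrite V0 inE.
  case=> x0 _.
  case: (arg_minP g (isT : xpredT x0)) => u _ umin; case: (arg_maxP g (isT : xpredT x0)) => v _ vmax.
  rewrite -big_mkcond (eq_bigl (fun t => g u <= g t < g v)); last first.
    move=> t; rewrite umin //=; apply/existsP/idP => [[y ty]|]; last by exists v.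
    exact: lt_le_trans ty (vmax y isT).
  rewrite H ?umin //; have := gM u; have := gM v; rewrite !ler_norml => /andP[? ?] /andP[? ?]; lra.
- move=> u v uv; rewrite -H //; apply: eq_bigr => t /andP[_ tv].
  by case: existsP => // -[]; exists v.
Qed.
End Threshold.

Section RandomCut.
Variables (R : realType) (V I : finType) (z : V -> I -> R).

Definition splits (B e : {set V}) := (e :&: B != finset.set0) && (e :\: B != finset.set0).

Let S := {ffun I -> bool}.
Let x (s : S) v := rademacher (z v) s.

Let rademacherB s u v : x s u - x s v = rademacher (fun i => z u i - z v i) s.
Proof. by rewrite /x /rademacher -sumrB; apply: eq_bigr => i _; rewrite mulrBr. Qed.

(* Chernoff: [lam * max_u |x_u - x_u0| <= c - 1 + \sum_u exp(lam |x_u - x_u0| - c)], where [c] makes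
   the expectation of the last sum at most 1. *)
Let sum_spread_le (e : {set V}) (r : nat) (L : R) (gap : S -> R) :
  (2 <= r)%N -> (#|e| <= r)%N -> 0 < L ->
  (forall u v, u \in e -> v \in e -> sqdist z u v <= L ^+ 2) ->
  (forall s, exists u v, [/\ u \in e, v \in e & gap s = x s v - x s u]) ->
  \sum_s gap s <= #|S|%:R * (8 * Num.sqrt (ln r%:R) * L).
Proof.
move=> r2 er L0 eL gapE.
have r0 : 0 < r%:R :> R by rewrite ltr0n (leq_trans _ r2).
have lnr : 0 < ln r%:R :> R by rewrite ln_gt0 // ltr1n.
set q := Num.sqrt _; have q0 : 0 < q by rewrite sqrtr_gt0.
have q2 : q ^+ 2 = ln r%:R by rewrite sqr_sqrtr // ltW.
pose lam := q / L; have lam0 : 0 < lam by rewrite divr_gt0.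
pose c := ln (2 * r%:R) + 2 * (lam * L) ^+ 2.
have c_le : c <= 4 * q ^+ 2.
  rewrite /c /lam -mulrA mulVf ?gt_eqF // mulr1 lnM ?posrE //.
  have : ln 2 <= ln r%:R :> R by rewrite ler_ln ?posrE // ler_nat.
  by rewrite q2; lra.
have [u0 u0e|e0] := pickP (mem e); last first.
  rewrite big1 => [|s _]; first by rewrite !mulr_ge0 ?(ltW L0) ?(ltW q0).
  by have [u [v [ue _ _]]] := gapE s; have := e0 u; rewrite /= ue.
pose y u s := lam * (x s u - x s u0).
pose Psi s := \sum_(u in e) (expR (y u s) + expR (- y u s)) * expR (- c).
have sumPsi : \sum_s Psi s <= #|S|%:R.
  rewrite exchange_big /=.
  apply: (@le_trans _ _ (\sum_(u in e) #|S|%:R / r%:R)); last first.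
    by rewrite sumr_const -[leLHS]mulr_natl mulrCA ler_piMr // ler_pdivrMr // mul1r ler_nat.
  apply: ler_sum => u ue; rewrite -mulr_suml big_split /=.
  have bnd (a : R) : a ^+ 2 = lam ^+ 2 -> \sum_s expR (a * (x s u - x s u0)) <= #|S|%:R * expR (2 * (lam * L) ^+ 2).
    move=> a2; under eq_bigr do rewrite rademacherB.
    have -> : \sum_s expR (a * rademacher (fun i => z u i - z u0 i) s) =
       \sum_s expR (rademacher (fun i => a * (z u i - z u0 i)) s).
      apply: eq_bigr => s _; congr expR; rewrite /rademacher mulr_sumr.
      by apply: eq_bigr => i _; rewrite mulrCA.
    apply: le_trans (sum_expR_rademacher _) _.
    rewrite ler_wpM2l // ler_expR ler_pM2l //.
    under eq_bigr do rewrite exprMn a2.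
    by rewrite -mulr_sumr [leRHS]exprMn ler_wpM2l ?sqr_ge0 // eL.
  have E : expR (- c) = (2 * r%:R)^-1 * expR (- (2 * (lam * L) ^+ 2)).
    by rewrite /c opprD expRD expRN lnK // posrE mulr_gt0.
  have := lerD (bnd lam erefl) (bnd (- lam) (sqrrN _)).
  under [X in _ + X <= _ -> _]eq_bigr do rewrite mulNr.
  rewrite -/(y u _) => H.
  apply: (le_trans (ler_wpM2r (expR_ge0 _) H)).
  rewrite E; set a := 2 * (lam * L) ^+ 2; have : expR a * expR (- a) = 1 by rewrite expRN mulfV // gt_eqF // expR_gt0.
  move: (expR a) (expR (- a)) => A B AB.
  have -> : (#|S|%:R * A + #|S|%:R * A) * ((2 * r%:R)^-1 * B) = #|S|%:R / r%:R * (A * B).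
    by field; rewrite gt_eqF.
  by rewrite AB mulr1.
have gap_le s : lam * gap s <= 2 * (c - 1 + Psi s).
  have bnd u : u \in e -> lam * `|x s u - x s u0| <= c - 1 + Psi s.
    move=> ue; have := expR_ge1Dx (lam * `|x s u - x s u0| - c).
    have : expR (lam * `|x s u - x s u0| - c) <= Psi s.
      rewrite /Psi (bigD1 u) //= expRD; apply: ler_wpDr.
        by apply: sumr_ge0 => v _; rewrite mulr_ge0 ?addr_ge0 ?expR_ge0.
      rewrite ler_pM2r ?expR_gt0 // /y.
      by have [h|h] := ger0P (x s u - x s u0); rewrite ?mulrN ?lerDl ?lerDr expR_ge0.
    lra.
  have [u [v [ue ve ->]]] := gapE s.
  have := bnd u ue; have := bnd v ve.
  have := ler_wpM2l (ltW lam0) (ler_norm (x s v - x s u0)).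
  have := ler_wpM2l (ltW lam0) (ler_norm (- (x s u - x s u0))); rewrite normrN; lra.
have : lam * \sum_s gap s <= #|S|%:R * (2 * c).
  rewrite mulr_sumr; apply: (le_trans (ler_sum _ (fun s _ => gap_le s))).
  by rewrite -mulr_sumr big_split /= sumr_const -[_ *+ _]mulr_natl; lra.
rewrite -ler_pdivlMl // => /le_trans; apply.
rewrite mulrCA ler_wpM2l // ler_pdivrMl // /lam.
have -> : q / L * (8 * q * L) = 8 * q ^+ 2 by field; rewrite gt_eqF.
lra.
Qed.

Lemma random_cut : exists (Om : finType) (p : Om -> R) (B : Om -> {set V}) (kap : R),
  [/\ 0 < kap <= 1, forall o, 0 <= p o, \sum_o p o = 1,
    forall u v, kap / 4 * Num.sqrt (sqdist z u v) <= \sum_(o | (u \in B o) != (v \in B o)) p o &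
    forall (e : {set V}) (r : nat) (L : R), (2 <= r)%N -> (#|e| <= r)%N -> 0 <= L ->
      (forall u v, u \in e -> v \in e -> sqdist z u v <= L ^+ 2) ->
      \sum_(o | splits (B o) e) p o <= kap * (8 * Num.sqrt (ln r%:R) * L)].
Proof.
pose M : R := 1 + \sum_s \sum_v `|x s v|.
have sum0 s : 0 <= \sum_v `|x s v| by apply: sumr_ge0.
have M0 : 0 < M by rewrite ltr_pwDl // sumr_ge0.
have xM s v : `|x s v| <= M.
  apply: ler_wpDl => //; rewrite (bigD1 s) //=; apply: ler_wpDr; first exact: sumr_ge0.
  by rewrite (bigD1 v) //= lerDl sumr_ge0.
have /boolp.choice[om Hom] s := threshold_weights_le (ltW M0) (xM s).
have om0 s t : 0 <= om s t by case: (Hom s).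
have omM s : \sum_t om s t <= 2 * M by case: (Hom s).
have omE s u v : x s u <= x s v -> \sum_(t | x s u <= x s t < x s v) om s t = x s v - x s u.
  by case: (Hom s) => _ _; apply.
have nS : 0 < #|S|%:R :> R by rewrite ltr0n; apply/card_gt0P; exists [ffun=> false].
pose nrm := (2 * M * #|S|%:R)^-1; have nrm0 : 0 < nrm by rewrite invr_gt0 !mulr_gt0.
pose p (o : S * option V) := nrm * (if o.2 is Some t then om o.1 t else 2 * M - \sum_t om o.1 t).
pose B (o : S * option V) := if o.2 is Some t then [set v | x o.1 t < x o.1 v] else finset.set0.
have sumE (P : {set V} -> bool) : ~~ P finset.set0 ->
    \sum_(o | P (B o)) p o = nrm * \sum_s \sum_(t | P [set v | x s t < x s v]) om s t.
  move=> P0; rewrite mulr_sumr big_mkcond /=.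
  rewrite -(pair_bigA _ (fun s o => if P (B (s, o)) then p (s, o) else 0)) /=; apply: eq_bigr => s _.
  rewrite (bigD1 None) //= {1}/B /= (negPf P0) add0r mulr_sumr.
  rewrite (reindex_omap Some id) /=; last by case.
  rewrite [RHS]big_mkcond /= [LHS]big_mkcond; apply: eq_bigr => t _.
  by rewrite eqxx.
have sepE s u v : x s u <= x s v ->
    \sum_(t | (u \in [set v | x s t < x s v]) != (v \in [set v | x s t < x s v])) om s t = x s v - x s u.
  move=> uv; rewrite -omE //; apply: eq_bigl => t; rewrite !inE.
  by case: (ltP (x s t) (x s u)) => [h|_] /=; [rewrite (lt_le_trans h uv) | case: (_ < _)].
exists (S * option V)%type, p, B, (2 * M)^-1; split.
- rewrite invr_gt0 mulr_gt0 //= invf_le1 ?mulr_gt0 //.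
  have : 1 <= M by rewrite lerDl sumr_ge0.
  by lra.
- by case=> s [t|]; rewrite /p /= mulr_ge0 ?(ltW nrm0) // subr_ge0.
- rewrite -(pair_bigA _ (fun s o => p (s, o))) /=.
  transitivity (\sum_(s : S) nrm * (2 * M)).
    apply: eq_bigr => s _; rewrite (bigD1 None) //= (reindex_omap Some id) /=; last by case.
    rewrite /p /= -mulr_sumr -mulrDr; congr (_ * _).
    by rewrite [X in _ + X = _](eq_bigl xpredT) => [|t]; [rewrite subrK | rewrite eqxx].
  by rewrite sumr_const -[LHS]mulr_natl /nrm; field; rewrite !gt_eqF.
- move=> u v; rewrite (sumE (fun A => (u \in A) != (v \in A))); last by rewrite !inE.
  have -> : \sum_s \sum_(t | (u \in [set v | x s t < x s v]) != (v \in [set v | x s t < x s v])) om s t =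
     \sum_s `|rademacher (fun i => z u i - z v i) s|.
    apply: eq_bigr => s _; rewrite -rademacherB.
    have [uv|/ltW vu] := leP (x s u) (x s v).
      by rewrite sepE // distrC ger0_norm // subr_ge0.
    rewrite ger0_norm ?subr_ge0 // -(sepE _ _ _ vu); apply: eq_bigl => t.
    by rewrite eq_sym.
  apply: (@le_trans _ _ (nrm * (#|S|%:R * (Num.sqrt (sqdist z u v) / 4)))).
    by rewrite le_eqVlt; apply/orP; left; apply/eqP; rewrite /nrm; field; rewrite !gt_eqF.
  by rewrite ler_pM2l // sum_rademacher1_ge.
move=> e r L r2 er L0 eL.
rewrite (sumE (fun A => splits A e)); last by rewrite /splits finset.setI0 eqxx.
pose gap s := \sum_(t | splits [set v | x s t < x s v] e) om s t.
have [-> | [u0 u0e]] := set_0Vmem e.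
  rewrite big1 ?mulr0 => [|s _]; last by rewrite big1 // => t; rewrite /splits finset.set0I eqxx.
  by rewrite mulr_ge0 ?invr_ge0 ?mulr_ge0 ?(ltW M0) // sqrtr_ge0.
have gapE s : exists u v, [/\ u \in e, v \in e & gap s = x s v - x s u].
  case: (arg_minP (x s) u0e) => u ue umin; case: (arg_maxP (x s) u0e) => v ve vmax.
  have {}ue : u \in e := ue; have {}ve : v \in e := ve.
  exists u, v; split=> //; rewrite -omE ?umin //; apply: eq_bigl => t.
  rewrite /splits andbC; congr (_ && _).
    apply/set0Pn/idP => [[y]|ut]; last by exists u; rewrite !inE ue andbT -leNgt.
    by rewrite !inE -leNgt => /andP[yt ye]; apply: le_trans yt; apply: umin.
  apply/set0Pn/idP => [[y]|ut]; last by exists v; rewrite !inE ve.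
  by rewrite !inE => /andP[ye ty]; apply: lt_le_trans ty _; apply: vmax.
have Hpos (L' : R) : 0 < L' -> L <= L' -> \sum_s gap s <= #|S|%:R * (8 * Num.sqrt (ln r%:R) * L').
  move=> L'0 LL'; apply: (sum_spread_le r2 er L'0) => // u v ue ve.
  by apply: le_trans (eL u v ue ve) _; rewrite ler_sqr // nnegrE ltW.
have -> : (2 * M)^-1 * (8 * Num.sqrt (ln r%:R) * L) = nrm * (#|S|%:R * (8 * Num.sqrt (ln r%:R) * L)).
  by rewrite /nrm; field; rewrite !gt_eqF.
rewrite ler_pM2l //; have [Lp|] := ltP 0 L; first exact: Hpos.
move=> Ln; have {}L0 : L = 0 by apply/eqP; rewrite eq_le Ln L0.
rewrite L0 !mulr0; apply/ler_addgt0Pr => eta eta0; rewrite add0r.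
pose K := #|S|%:R * (8 * Num.sqrt (ln r%:R)) + 1 : R.
have K0 : 0 < K by rewrite ltr_wpDl // !mulr_ge0 // sqrtr_ge0.
have eK := divr_gt0 eta0 K0.
have := Hpos _ eK; rewrite L0 => /(_ (ltW eK)) /le_trans; apply.
have {2}-> : eta = eta / K * K by rewrite divfK // gt_eqF.
by rewrite mulrA [leRHS]mulrC ler_wpM2r ?(ltW eK) // /K lerDl.
Qed.
End RandomCut.

(** * Hashing by independent cuts *)

Section Hashing.
Variables (R : realType) (V Om : finType) (p : Om -> R) (B : Om -> {set V}) (h : nat).
Hypotheses (p_ge0 : forall o, 0 <= p o) (sum_p : \sum_o p o = 1).
Local Notation OmH := {ffun 'I_h -> Om}.

Definition prodp (om : OmH) : R := \prod_j p (om j).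
Definition hash (om : OmH) (u : V) : {ffun 'I_h -> bool} := [ffun j => u \in B (om j)].

Lemma prodp_ge0 om : 0 <= prodp om.
Proof. by apply: prodr_ge0. Qed.

Lemma sum_prodp (G : Om -> R) :
  \sum_om prodp om * \prod_j G (om j) = (\sum_o p o * G o) ^+ h.
Proof.
rewrite -[h in RHS]card_ord -prodr_const bigA_distr_bigA /=.
by apply: eq_bigr => om _; rewrite big_split.
Qed.

Lemma sum_prodp1 : \sum_om prodp om = 1.
Proof.
transitivity (\sum_om prodp om * \prod_(j < h) 1).
  by apply: eq_bigr => om _; rewrite big1 ?mulr1.
rewrite (sum_prodp (fun=> 1)); under eq_bigr do rewrite mulr1.
by rewrite sum_p expr1n.
Qed.

Lemma prob_hash_collision u v :
  \sum_(om | hash om u == hash om v) prodp om =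
  (1 - \sum_(o | (u \in B o) != (v \in B o)) p o) ^+ h.
Proof.
have -> : 1 - \sum_(o | (u \in B o) != (v \in B o)) p o =
    \sum_o p o * ((u \in B o) == (v \in B o))%:R.
  rewrite -[X in X - _ = _]sum_p (bigID (fun o => (u \in B o) == (v \in B o))) /= addrK big_mkcond.
  by apply: eq_bigr => o _; case: eqP; rewrite ?mulr1 ?mulr0.
rewrite -sum_prodp big_mkcond; apply: eq_bigr => om _.
case: eqP => [/ffunP E|nE].
  by rewrite big1 ?mulr1 // => j _; have := E j; rewrite !ffunE => ->; rewrite eqxx.
have /existsP[j nj] : [exists j, (u \in B (om j)) != (v \in B (om j))].
  apply: contra_notT nE; rewrite negb_exists => /forallP E.
  by apply/ffunP => j; rewrite !ffunE; apply/eqP; have := E j; rewrite negbK.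
by rewrite (bigD1 j) //= (negPf nj) mul0r mulr0.
Qed.

Lemma card_hash_le om (e : {set V}) :
  (#|hash om @: e| <= \prod_j (splits (B (om j)) e).+1)%N.
Proof.
have sub : hash om @: e \subset family (fun j => [pred b : bool | [exists u in e, (u \in B (om j)) == b]]).
  apply/fintype.subsetP => _ /imsetP[u ue ->]; apply/familyP => j.
  by rewrite inE ffunE; apply/existsP; exists u; rewrite ue eqxx.
apply: leq_trans (subset_leq_card sub) _; rewrite card_family.
rewrite (foldrE) big_map big_enum /=; apply: leq_prod => j _.
have [|] := boolP (splits _ _) => [_|ns]; first by rewrite (leq_trans (max_card _)) ?card_bool.
apply/fintype.card_le1_eqP => b b' /existsP[u /andP[ue /eqP<-]] /existsP[v /andP[ve /eqP<-]].
have side x y : x \in e -> y \in e -> x \in B (om j) -> y \in B (om j).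
  move=> xe ye xB; apply: contraNT ns => yB; apply/andP.
  by split; apply/set0Pn; [exists x | exists y]; rewrite !inE ?xe ?ye ?xB ?yB.
by apply/idP/idP; apply: side.
Qed.

Lemma expected_cells (e : {set V}) :
  \sum_om prodp om * #|hash om @: e|%:R <= (1 + \sum_(o | splits (B o) e) p o) ^+ h.
Proof.
have -> : 1 + \sum_(o | splits (B o) e) p o = \sum_o p o * (splits (B o) e).+1%:R.
  rewrite -[X in X + _ = _]sum_p [X in _ + X = _]big_mkcond -big_split; apply: eq_bigr => o _ /=.
  rewrite -natr1 mulrDr mulr1 addrC; by case: (splits _ _); rewrite ?mulr1 ?mulr0.
rewrite -sum_prodp; apply: ler_sum => om _; apply: ler_wpM2l; first exact: prodp_ge0.
by rewrite -natr_prod ler_nat card_hash_le.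
Qed.
End Hashing.

Section Merging.
Variables (R : realType) (T : finType) (mu : T -> R) (a : R).
Hypotheses (mu_ge0 : forall c, 0 <= mu c) (mu_le : forall c, mu c <= a) (a_ge1 : 1 <= a).

(* Colours below [m] are completed groups, colour [m] collects the light leftovers. *)
Let merge_seq (s : seq T) : uniq s -> exists (m : nat) (col : T -> nat),
  [/\ forall i, (i < m)%N -> 4^-1 <= \sum_(c <- s | col c == i) mu c,
    \sum_(c <- s | col c == m) mu c <= 4^-1,
    forall c, (col c <= m)%N &
    \sum_(c <- s) mu c <= m%:R * a + \sum_(c <- s | col c == m) mu c].
Proof.
elim: s => [_|x s IH /= /andP[xs us]].
  by exists 0%N, (fun=> 0%N); split; rewrite ?big_nil // ?invr_ge0 // mul0r addr0.
have {IH}[m [col [Hbig Hm colm Hs]]] := IH us.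
have sumE (P Q : pred T) : {in s, P =1 Q} -> \sum_(c <- s | P c) mu c = \sum_(c <- s | Q c) mu c.
  move=> PQ; rewrite big_mkcond [RHS]big_mkcond; apply: eq_big_seq => c cs.
  by rewrite (PQ c cs).
have cx c : c \in s -> (c == x) = false by move=> cs; apply: contraNF xs => /eqP<-.
have [x4|x4] := lerP 4^-1 (mu x).
  exists m.+1, (fun c => if c == x then m else if col c == m then m.+1 else col c).
  have E i : (i < m)%N -> \sum_(c <- s | (if c == x then m else if col c == m then m.+1 else col c) == i) mu c =
      \sum_(c <- s | col c == i) mu c.
    move=> im; apply: sumE => c cs; rewrite (cx c cs); case: (col c =P m) => // ->.
    by rewrite !gtn_eqF // ltnW.
  have Em : \sum_(c <- s | (if c == x then m else if col c == m then m.+1 else col c) == m.+1) mu c =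
      \sum_(c <- s | col c == m) mu c.
    apply: sumE => c cs; rewrite (cx c cs); case: (col c =P m) => [_|_]; first by rewrite eqxx.
    by rewrite ltn_eqF // ltnS.
  split.
  - move=> i; rewrite ltnS leq_eqVlt => /orP[/eqP->|im]; rewrite big_cons eqxx.
      rewrite eqxx; apply: ler_wpDr => //; exact: sumr_ge0.
    by rewrite gtn_eqF // E // Hbig.
  - by rewrite big_cons eqxx ltn_eqF // Em.
  - by move=> c; case: eqP => // _; case: eqP => // _; apply: leqW.
  - rewrite !big_cons eqxx ltn_eqF // Em -natr1; have := mu_le x; lra.
pose col' c := if c == x then m else col c.
have E i : \sum_(c <- s | col' c == i) mu c = \sum_(c <- s | col c == i) mu c.
  by apply: sumE => c cs; rewrite /col' (cx c cs).
have colx : col' x = m by rewrite /col' eqxx.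
have cm c : (col' c <= m)%N by rewrite /col'; case: eqP.
have [l4|l4] := lerP (mu x + \sum_(c <- s | col c == m) mu c) 4^-1.
  exists m, col'; split=> //.
  - by move=> i im; rewrite big_cons colx gtn_eqF // E Hbig.
  - by rewrite big_cons colx eqxx E.
  - by rewrite !big_cons colx eqxx E; lra.
exists m.+1, col'; split=> //.
- move=> i; rewrite ltnS leq_eqVlt => /orP[/eqP->|im]; rewrite big_cons colx E.
    by rewrite eqxx ltW.
  by rewrite gtn_eqF // Hbig.
- rewrite big_cons colx ltn_eqF // E big1_seq ?invr_ge0 // => c /andP[/eqP cE _].
  by have := colm c; rewrite cE ltnn.
- by move=> c; apply: leqW.
- rewrite !big_cons colx ltn_eqF // E [X in _ <= _ + X]big1_seq; last first.
    by move=> c /andP[/eqP cE _]; have := colm c; rewrite cE ltnn.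
  rewrite -natr1; have := a_ge1; lra.
Qed.

Lemma merge_light : exists (m : nat) (G : 'I_m -> {set T}),
  [/\ forall i, 4^-1 <= \sum_(c in G i) mu c,
    forall i j, i != j -> [disjoint G i & G j] & \sum_c mu c <= m%:R * a + 4^-1].
Proof.
have [m [col [Hbig Hm _ Hs]]] := merge_seq (index_enum_uniq T).
exists m, (fun i : 'I_m => [set c | col c == i]); split.
- by move=> i; under eq_bigl do rewrite inE; apply: Hbig.
- move=> i j ij; rewrite -setI_eq0; apply/eqP/setP => c; rewrite !inE.
  by apply: contraNF ij => /andP[/eqP ci /eqP cj]; apply/eqP/val_inj; rewrite /= -ci.
- by apply: le_trans Hs _; rewrite lerD2l.
Qed.
End Merging.

(** * Cells and level sets *)

Section Geometry.
Variables (R : realType) (V I : finType) (f : V -> I -> R).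

Definition enorm v := Num.sqrt (dotp f v v).
(* The zero vector gets direction [0]. *)
Definition direction v i := f v i / enorm v.
Local Notation z := direction.

Lemma enorm_ge0 v : 0 <= enorm v. Proof. exact: sqrtr_ge0. Qed.

Lemma sqr_enorm v : enorm v ^+ 2 = dotp f v v.
Proof. by rewrite sqr_sqrtr // dotp_ge0. Qed.

Lemma dotp_le_enorm u v : `|dotp f u v| <= enorm u * enorm v.
Proof.
rewrite -ler_sqr ?nnegrE ?mulr_ge0 ?enorm_ge0 // real_normK ?num_real // exprMn !sqr_enorm.
have := sum_cauchy_schwarz xpredT (f u) (f v); rewrite /dotp.
by under [X in _ <= X * _ -> _]eq_bigr do rewrite expr2; under [X in _ <= _ * X -> _]eq_bigr do rewrite expr2.
Qed.

Lemma sqr_enormB_le u v : (enorm u - enorm v) ^+ 2 <= sqdist f u v.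
Proof.
have := dotp_le_enorm u v; rewrite ler_norml => /andP[_ H].
by rewrite sqdistE -!sqr_enorm; lra.
Qed.

Lemma dotp_direction u v : dotp z u v = dotp f u v / (enorm u * enorm v).
Proof. by rewrite /dotp mulr_suml; apply: eq_bigr => i _; rewrite /z invfM mulrACA. Qed.

Lemma sqdist_direction_le u v : enorm u <= enorm v ->
  sqdist z u v * enorm v ^+ 2 <= 4 * sqdist f u v.
Proof.
move=> uv; have [v0|v0] := eqVneq (enorm v) 0.
  by rewrite v0 expr0n mulr0 mulr_ge0 // sqdist_ge0.
have b0 : 0 < enorm v by rewrite lt_def v0 enorm_ge0.
have := dotp_le_enorm u v; rewrite !sqdistE !dotp_direction -!sqr_enorm ler_norml.
have := enorm_ge0 u; move: (enorm u) (enorm v) (dotp f u v) uv b0 => a b c ab b0 a0 /andP[c1 c2].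
have [a00|an0] := eqVneq a 0.
  have -> : c = 0 by apply/eqP; rewrite eq_le; move: c1 c2; rewrite a00 mul0r oppr0 => -> ->.
  rewrite a00 !mul0r invr0 !expr0n !mul0r mulr0 -expr2 divff ?expf_neq0 ?gt_eqF //=.
  by rewrite mulr0n add0r !subr0 mul1r add0r ler_peMl ?sqr_ge0 // ler1n.
have ap : 0 < a by rewrite lt_def an0.
have -> : a ^+ 2 / (a * a) + b ^+ 2 / (b * b) - 2 * (c / (a * b)) = 2 * (a * b - c) / (a * b).
  by field; rewrite an0 gt_eqF.
have ab0 := mulr_gt0 ap b0.
have [s Hs] : exists s, s = 2 * (a * b - c) / (a * b) by eexists.
rewrite -Hs; have Hc : 2 * c = a * b * (2 - s) by rewrite Hs; field; rewrite an0 gt_eqF.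
have s0 : 0 <= s by rewrite Hs divr_ge0 ?(ltW ab0) //; lra.
have s4 : s <= 4 by rewrite Hs ler_pdivrMr //; lra.
rewrite Hc; have -> : 4 * (a ^+ 2 + b ^+ 2 - a * b * (2 - s)) = 4 * (a - b) ^+ 2 + 4 * (a * b) * s by ring.
have [h|h] := lerP (4 * a) b; last first.
  apply: ler_wpDl; first by rewrite mulr_ge0 // sqr_ge0.
  by rewrite [leLHS]mulrC ler_wpM2r // expr2 mulrA ler_wpM2r ?(ltW b0) // ltW.
have : 0 <= (4 - s) * (b * (b - 4 * a)) by rewrite !mulr_ge0 ?(ltW b0) //; lra.
have := mulr_ge0 a0 a0; have := mulr_ge0 a0 (ltW b0); rewrite -expr2 => *.
have -> : (a - b) ^+ 2 = a ^+ 2 + b ^+ 2 - 2 * (a * b) by ring.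
by lra.
Qed.

Lemma sqdist_triangle (g : V -> I -> R) u v x : sqdist g u v <= 2 * (sqdist g u x + sqdist g v x).
Proof.
rewrite /sqdist -big_split mulr_sumr; apply: ler_sum => i _ /=.
by have := sqr_ge0 (g u i + g v i - 2 * g x i); lra.
Qed.

Lemma sqdist_direction_edge (e : {set V}) (D : R) (x u v : V) :
  (forall u v, u \in e -> v \in e -> sqdist f u v <= D) ->
  (forall u, u \in e -> enorm u <= enorm x) -> x \in e -> u \in e -> v \in e -> 0 < enorm x ->
  sqdist z u v <= (4 * Num.sqrt D / enorm x) ^+ 2.
Proof.
move=> HD xmax xe ue ve x0.
have D0 : 0 <= D by have := HD x x xe xe; rewrite sqdistxx.
have bnd y : y \in e -> sqdist z y x <= 4 * D / enorm x ^+ 2.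
  move=> ye; rewrite ler_pdivlMr ?exprn_gt0 //.
  apply: le_trans (sqdist_direction_le (xmax y ye)) _; rewrite ler_pM2l //; exact: HD.
have -> : (4 * Num.sqrt D / enorm x) ^+ 2 = 2 * (4 * D / enorm x ^+ 2 + 4 * D / enorm x ^+ 2).
  by rewrite !exprMn exprVn sqr_sqrtr //; field; rewrite gt_eqF.
by apply: le_trans (sqdist_triangle _ _ _ x) _; rewrite ler_pM2l // lerD // bnd.
Qed.

Lemma sqr_enormB_edge (D : R) (x u v : V) : 0 <= D -> sqdist f u v <= D ->
  enorm u <= enorm x -> enorm v <= enorm x ->
  dotp f u u - dotp f v v <= 2 * Num.sqrt D * enorm x.
Proof.
move=> D0 uvD ux vx; rewrite -!sqr_enorm.
have : `|enorm u - enorm v| <= Num.sqrt D.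
  by rewrite -ler_sqr ?nnegrE ?sqrtr_ge0 // real_normK ?num_real // sqr_sqrtr // (le_trans (sqr_enormB_le _ _)).
rewrite ler_norml => /andP[_ H].
have u0 := enorm_ge0 u; have v0 := enorm_ge0 v; have d0 := sqrtr_ge0 D.
have -> : enorm u ^+ 2 - enorm v ^+ 2 = (enorm u - enorm v) * (enorm u + enorm v) by ring.
apply: (@le_trans _ _ (Num.sqrt D * (enorm u + enorm v))).
  by apply: ler_wpM2r => //; lra.
rewrite [2 * _]mulrC -mulrA; apply: ler_wpM2l => //; lra.
Qed.

End Geometry.

Section CellMass.
Variables (R : realType) (V I : finType) (d : V -> R) (f : V -> I -> R) (k eps : R).
Hypotheses (d_gt0 : forall v, 0 < d v) (f_iso : sub_isotropic d k f).
Hypotheses (eps_gt0 : 0 < eps) (eps_le1 : eps <= 1).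

Definition mass v := d v * dotp f v v.
Definition far u v := eps / 32 <= sqdist (direction f) u v.

Lemma mass_ge0 v : 0 <= mass v.
Proof. by rewrite mulr_ge0 ?dotp_ge0 // ltW. Qed.

Lemma sum_mass_direction u : dotp f u u != 0 ->
  \sum_v mass v * dotp (direction f) u v ^+ 2 <= 1.
Proof.
move=> u0; have up : 0 < dotp f u u by rewrite lt_def u0 dotp_ge0.
apply: (@le_trans _ _ (\sum_v (dotp f u u)^-1 * (d v * dotp f u v ^+ 2))).
  apply: ler_sum => v _; rewrite dotp_direction expr_div_n exprMn !sqr_enorm /mass.
  have [v0|v0] := eqVneq (dotp f v v) 0.
    by rewrite v0 mulr0 mul0r mulr_ge0 ?invr_ge0 ?(ltW up) // mulr_ge0 ?sqr_ge0 // ltW.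
  by rewrite le_eqVlt; apply/orP; left; apply/eqP; field; rewrite u0 v0.
by rewrite -mulr_sumr ler_pdivrMl // mulr1 f_iso.2.
Qed.

Lemma near_dotp u v : dotp f u u != 0 -> dotp f v v != 0 -> ~~ far u v ->
  1 - eps / 32 <= dotp (direction f) u v ^+ 2.
Proof.
move=> u0 v0; rewrite /far -ltNge sqdistE.
have dd x : dotp f x x != 0 -> dotp (direction f) x x = 1.
  by move=> x0; rewrite dotp_direction -expr2 sqr_enorm divff.
rewrite !dd //; set c := dotp _ u v => H.
nra.
Qed.

Lemma near_mass u : 0 < mass u -> (1 - eps / 32) * \sum_(v | ~~ far u v) mass v <= 1.
Proof.
move=> mu; have u0 : dotp f u u != 0.
  by apply: contraTneq mu => u0; rewrite /mass u0 mulr0 ltxx.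
apply: le_trans (sum_mass_direction u0).
rewrite mulr_sumr [leLHS]big_mkcond; apply: ler_sum => v _.
case: ifP => fv; last by rewrite mulr_ge0 ?mass_ge0 ?sqr_ge0.
rewrite mulrC; have [v0|v0] := eqVneq (dotp f v v) 0.
  by rewrite /mass v0 mulr0 !mul0r.
by apply: ler_wpM2l; [exact: mass_ge0 | apply: near_dotp].
Qed.

Lemma cell_mass_le (Q : {set V}) (coll : R) :
  \sum_(u in Q) \sum_(v in Q | far u v) mass u * mass v <= coll -> coll <= eps / 32 ->
  \sum_(v in Q) mass v <= 1 + eps / 8.
Proof.
move=> Hcoll ceps; set x := \sum_(v in Q) mass v.
have x0 : 0 <= x by apply: sumr_ge0 => v _; apply: mass_ge0.
have : (1 - eps / 32) * x ^+ 2 <= x + coll.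
  have -> : x ^+ 2 = \sum_(u in Q) mass u * \sum_(v in Q | ~~ far u v) mass v +
      \sum_(u in Q) \sum_(v in Q | far u v) mass u * mass v.
    rewrite expr2 {1}/x mulr_suml -big_split; apply: eq_bigr => u _ /=.
    by rewrite /x (bigID (far u)) /= mulrDr addrC mulr_sumr.
  rewrite mulrDr; apply: lerD; last first.
    apply: le_trans Hcoll; rewrite ler_piMl //.
      by rewrite sumr_ge0 // => u _; rewrite sumr_ge0 // => v _; rewrite mulr_ge0 ?mass_ge0.
    by have := eps_gt0; lra.
  rewrite mulr_sumr; apply: ler_sum => u _; rewrite mulrCA.
  have [m0|m0] := eqVneq (mass u) 0; first by rewrite m0 mul0r.
  have mp : 0 < mass u by rewrite lt_def m0 mass_ge0.
  rewrite ler_piMr ?(ltW mp) //; apply: le_trans (near_mass mp).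
  rewrite ler_pM2l; last by (have := eps_le1; lra).
  rewrite [leLHS]big_mkcond [leRHS]big_mkcond; apply: ler_sum => v _.
  by case: (v \in Q); case: (far u v) => //=; rewrite mass_ge0.
move=> H; rewrite leNgt; apply/negP => xg.
have e0 := eps_gt0; have e1 := eps_le1; clearbody x.
have x1 : 1 < x by lra.
have H2 : 2 * (eps / 32) < (1 - eps / 32) * x - 1 by nra.
have : (1 - eps / 32) * x ^+ 2 - x = x * ((1 - eps / 32) * x - 1) by ring.
nra.
Qed.
End CellMass.

Section LevelSets.
Variables (R : realType) (V : finType) (m : V -> R).
Hypothesis m_ge0 : forall v, 0 <= m v.

Lemma level_weights : exists lev om : option V -> R, [/\ forall t, 0 <= om t,
  forall v, \sum_(t | lev t < m v) om t = m v &
  forall u v, m v <= m u -> \sum_(t | m v <= lev t < m u) om t = m u - m v].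
Proof.
pose g t := if t is Some v then m v else 0.
have [om [om0 H]] := threshold_weights g.
exists g, om; split=> // [v|u v vu]; last exact: (H (Some v) (Some u)).
rewrite -[RHS]subr0 -(H None (Some v)) //=; apply: eq_bigl => t.
by have -> : 0 <= g t by case: t => /=.
Qed.

Variables (lev om : option V -> R).
Hypotheses (om_ge0 : forall t, 0 <= om t) (om_lev : forall v, \sum_(t | lev t < m v) om t = m v)
  (om_between : forall u v, m v <= m u -> \sum_(t | m v <= lev t < m u) om t = m u - m v).

Definition level_set (Q : {set V}) t := [set v in Q | lev t < m v].
Definition level_cost (Q e : {set V}) := \sum_(t | splits (level_set Q t) e) om t.

Let sum_om_sub (P P' : pred (option V)) : (forall t, P t -> P' t) ->
  \sum_(t | P t) om t <= \sum_(t | P' t) om t.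
Proof.
move=> PP'; rewrite big_mkcond [leRHS]big_mkcond; apply: ler_sum => t _.
by have := PP' t; case: (P t) => [->|_] //; case: ifP.
Qed.

Lemma level_cost_ge0 Q e : 0 <= level_cost Q e.
Proof. exact: sumr_ge0. Qed.

Lemma level_cost_le Q (e : {set V}) x : (forall u, u \in e -> m u <= m x) -> level_cost Q e <= m x.
Proof.
move=> xmax; rewrite -om_lev; apply: sum_om_sub => t /andP[/set0Pn[u]].
by rewrite !inE => /and3P[ue _ tu] _; apply: lt_le_trans (xmax u ue).
Qed.

Lemma level_cost_untouched (Q e : {set V}) : [disjoint e & Q] -> level_cost Q e = 0.
Proof.
rewrite -setI_eq0 => /eqP/setP eQ; rewrite /level_cost big1 // => t /andP[/set0Pn[u]].
rewrite !inE => /and3P[ue uQ _].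
by have := eQ u; rewrite !inE ue uQ.
Qed.

Lemma level_cost_inside (Q e : {set V}) x y : e \subset Q -> m y <= m x ->
  (forall u, u \in e -> m y <= m u <= m x) -> level_cost Q e <= m x - m y.
Proof.
move=> /fintype.subsetP eQ yx yux; rewrite -om_between //.
apply: sum_om_sub => t /andP[/set0Pn[u] + /set0Pn[v]].
rewrite !inE => /and3P[ue _ tu] /andP[+ ve]; rewrite eQ // -leNgt => vt.
have /andP[_ ux] := yux u ue; have /andP[yv _] := yux v ve.
by rewrite (le_trans yv vt) (lt_le_trans tu ux).
Qed.

Variables (T : finType) (H : V -> T) (n : nat) (G : 'I_n -> {set T}).
Hypothesis G_disj : forall i j, i != j -> [disjoint G i & G j].
Definition group_set i := [set v | H v \in G i].

Lemma group_touched_le (e : {set V}) (b : R) :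
  (forall i, level_cost (group_set i) e <= b) -> 0 <= b ->
  \sum_i level_cost (group_set i) e <= #|H @: e|%:R * b.
Proof.
move=> Hb b0.
apply: (@le_trans _ _ (\sum_i \sum_(c in H @: e) (c \in G i)%:R * b)).
  apply: ler_sum => i _.
  have [d|] := boolP [disjoint e & group_set i].
    by rewrite level_cost_untouched // sumr_ge0 // => c _; rewrite mulr_ge0.
  rewrite -setI_eq0 => /set0Pn[u]; rewrite !inE => /andP[ue uG].
  rewrite (bigD1 (H u)) ?imset_f //= uG mul1r; apply: ler_wpDr; last exact: Hb.
  by apply: sumr_ge0 => c _; rewrite mulr_ge0.
rewrite exchange_big /= mulr_natl -sumr_const; apply: ler_sum => c _.
rewrite -mulr_suml ler_piMl //.
case: (pickP (fun i => c \in G i)) => [i0 ci0|c0]; last by rewrite big1 // => i _; rewrite c0.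
rewrite (bigD1 i0) //= ci0 big1 ?addr0 // => i /G_disj; rewrite disjoint_sym => /disjointFr ->//.
Qed.

Lemma group_cost_le (e : {set V}) x y : x \in e -> y \in e ->
  (forall u, u \in e -> m y <= m u <= m x) ->
  \sum_i level_cost (group_set i) e <= (m x - m y) + 2 * (#|H @: e|%:R - 1) * m x.
Proof.
move=> xe ye yux; have xmax u : u \in e -> m u <= m x by move=> /yux/andP[].
have yx : m y <= m x := xmax y ye.
have N1 : (0 < #|H @: e|)%N by apply/card_gt0P; exists (H x); apply: imset_f.
move: N1; rewrite leq_eqVlt => /orP[/eqP N1|N2].
  rewrite -N1 subrr mulr0 mul0r addr0 -[leRHS]mul1r -[1]/(1%:R) [in leRHS]N1.
  apply: group_touched_le; last by rewrite subr_ge0.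
  move=> i; have [d|] := boolP [disjoint e & group_set i].
    by rewrite level_cost_untouched // subr_ge0.
  rewrite -setI_eq0 => /set0Pn[u]; rewrite !inE => /andP[ue uG].
  apply: level_cost_inside => //; apply/fintype.subsetP => v ve; rewrite inE.
  have /eqP/cards1P[c Hc] := esym N1.
  have := imset_f H ue; have := imset_f H ve; rewrite Hc !inE => /eqP-> /eqP Hu.
  by rewrite -Hu.
apply: le_trans (group_touched_le (b := m x) _ _) _ => //.
  by move=> i; apply: level_cost_le.
have : 2 <= #|H @: e|%:R :> R by rewrite ler_nat.
have := m_ge0 x; have := m_ge0 y; nra.
Qed.

Lemma group_cost_le_card (e : {set V}) x : x \in e -> (forall u, u \in e -> m u <= m x) ->
  \sum_i level_cost (group_set i) e <= n%:R * m x.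
Proof.
move=> xe xmax; apply: (@le_trans _ _ (\sum_(i < n) m x)).
  by apply: ler_sum => i _; apply: level_cost_le.
by rewrite sumr_const card_ord mulr_natl.
Qed.
End LevelSets.

Section GoodHash.
Variables (R : realType) (V I : finType) (E : {set {set V}}) (w : {set V} -> R).
Variables (k r : nat) (f : V -> I -> R) (D : {set V} -> R) (eps sigma : R).
Hypothesis w_ge0 : forall e, e \in E -> 0 <= w e.
Hypothesis wdeg_gt0 : forall v, 0 < wdeg E w v.
Hypotheses (k_ge2 : (2 <= k)%N) (r_ge2 : (2 <= r)%N).
Hypothesis rank_le : forall e, e \in E -> (#|e| <= r)%N.
Hypothesis f_iso : sub_isotropic (wdeg E w) k%:R f.
Hypothesis D_ge0 : forall e, e \in E -> 0 <= D e.
Hypothesis f_D : forall e u v, e \in E -> u \in e -> v \in e -> sqdist f u v <= D e.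
Hypotheses (sigma_gt0 : 0 < sigma) (sum_D : \sum_(e in E) w e * D e <= sigma).
Hypotheses (eps_lo : (2 * k%:R)^-1 <= eps) (eps_le1 : eps <= 1).

Definition peak (e : {set V}) : R := \big[Num.max/0]_(v in e) enorm f v.

Lemma peak_ge0 e : 0 <= peak e.
Proof. by apply: bigmax_ge_id. Qed.

Lemma peakP (e : {set V}) u : u \in e ->
  exists x, [/\ x \in e, enorm f x = peak e & forall v, v \in e -> enorm f v <= peak e].
Proof.
move=> ue; have le v : v \in e -> enorm f v <= peak e by move=> ve; apply: le_bigmax_cond.
case: (arg_maxP (enorm f) ue) => x xe xmax; exists x; split=> //.
apply/eqP; rewrite eq_le le //=; apply/bigmax_leP; split=> [|v ve]; first exact: enorm_ge0.
exact: xmax.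
Qed.

Lemma peak0 : peak finset.set0 = 0.
Proof. by rewrite /peak big_set0. Qed.

(* [1536 = 4 * 12 * 32]: a cut separates directions at distance [x] with probability at least [kap x / 4],
   there are at most [12 ln k / (kap Delta / 4)] cuts, and a cut splits [e] with probability at
   most [32 kap sqrt (ln r) sqrt (D e) / peak e]. *)
Definition hash_rate : R := 1536 * ln k%:R * Num.sqrt (ln r%:R) / Num.sqrt (eps / 32).
Local Notation X := hash_rate.
Definition short e := X * Num.sqrt (D e) <= peak e / 2.

Definition short_cost (T : finType) (H : V -> T) :=
  \sum_(e in E | short e) w e * (2 * Num.sqrt (D e) * peak e + 2 * (#|H @: e|%:R - 1) * peak e ^+ 2).
Definition short_bound : R := (2 + 4 * X) * Num.sqrt (sigma * k%:R).

Let k0 : 0 < k%:R :> R. Proof. by rewrite ltr0n (leq_trans _ k_ge2). Qed.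
Let eps0 : 0 < eps. Proof. by apply: lt_le_trans eps_lo; rewrite invr_gt0 mulr_gt0. Qed.

Lemma ln_ge_half (n : nat) : (2 <= n)%N -> 2^-1 <= ln n%:R :> R.
Proof.
move=> n2; have : ln 2 <= ln n%:R :> R by rewrite ler_ln ?posrE ?ler_nat // ltr0n (leq_trans _ n2).
apply: le_trans; rewrite -[leLHS]expRK ler_ln ?posrE ?expR_gt0 //.
have := expR_ge1Dx (- 2^-1 : R); have := expR_gt0 (2^-1 : R); rewrite expRN.
move: (expR _) => y y0; rewrite -(ler_pM2r y0) mulVf ?gt_eqF //; lra.
Qed.

Lemma hash_rate_gt0 : 0 < X.
Proof.
have a := ln_ge_half k_ge2; have b := ln_ge_half r_ge2.
rewrite divr_gt0 ?sqrtr_gt0 ?divr_gt0 // mulr_gt0 ?sqrtr_gt0 ?mulr_gt0 //; lra.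
Qed.

Lemma short_bound_gt0 : 0 < short_bound.
Proof. by rewrite mulr_gt0 ?sqrtr_gt0 ?mulr_gt0 //; have := hash_rate_gt0; lra. Qed.

Lemma sum_w_peak : \sum_(e in E) w e * peak e ^+ 2 <= k%:R.
Proof.
rewrite -f_iso.1 /wdeg.
under [leRHS]eq_bigr do rewrite mulr_suml.
rewrite (exchange_big_dep (fun e => e \in E)) /=; last by move=> v e _ /andP[].
apply: ler_sum => e eE; rewrite -mulr_sumr.
rewrite (eq_bigl (fun v => v \in e)) => [|v]; last by rewrite eE.
apply: ler_wpM2l; first exact: w_ge0.
have [->|[u ue]] := set_0Vmem e; first by rewrite peak0 expr0n big_set0.
have [x [xe <- _]] := peakP ue.
rewrite sqr_enorm (bigD1 x) //= lerDl sumr_ge0 // => v _; exact: dotp_ge0.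
Qed.

Lemma sum_w_D_peak : \sum_(e in E) w e * (Num.sqrt (D e) * peak e) <= Num.sqrt (sigma * k%:R).
Proof.
rewrite -[leLHS]ger0_norm; last first.
  by apply: sumr_ge0 => e eE; rewrite !mulr_ge0 ?w_ge0 ?sqrtr_ge0 ?peak_ge0.
rewrite -sqrtr_sqr ler_sqrt ?mulr_ge0 ?(ltW sigma_gt0) //.
have -> : \sum_(e in E) w e * (Num.sqrt (D e) * peak e) =
  \sum_(e in E) (Num.sqrt (w e) * Num.sqrt (D e)) * (Num.sqrt (w e) * peak e).
  by apply: eq_bigr => e eE; rewrite mulrACA -expr2 sqr_sqrtr ?w_ge0.
apply: le_trans (sum_cauchy_schwarz _ _ _) _.
apply: ler_pM; rewrite ?sumr_ge0 // => *; rewrite ?sqr_ge0 //.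
  apply: le_trans sum_D; apply: ler_sum => e eE.
  by rewrite exprMn !sqr_sqrtr ?w_ge0 ?D_ge0.
apply: le_trans sum_w_peak; apply: ler_sum => e eE.
by rewrite exprMn sqr_sqrtr ?w_ge0.
Qed.

Lemma expr1D_le (p : R) h : 0 <= p -> h%:R * p <= 2^-1 -> (1 + p) ^+ h <= 1 + 2 * (h%:R * p).
Proof.
move=> p0; elim: h => [|h IH]; first by rewrite expr0 mul0r mulr0 addr0.
rewrite -natr1 mulrDl mul1r => hp; have := IH ltac:(lra) => {}IH.
rewrite exprS; apply: (@le_trans _ _ ((1 + p) * (1 + 2 * (h%:R * p)))).
  by apply: ler_wpM2l => //; lra.
nra.
Qed.

Lemma good_hash : exists (T : finType) (H : V -> T),
  (forall c, \sum_(v | H v == c) mass (wdeg E w) f v <= 1 + eps / 8) /\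
  short_cost H <= 2 * short_bound.
Proof.
have [Om [p [B [kap [/andP[kap0 kap1] p0 p1 Hsep Hsplit]]]]] := random_cut (direction f).
have lnk := ln_ge_half k_ge2; have e1 := eps_le1.
pose Delta := Num.sqrt (eps / 32); have Delta0 : 0 < Delta by rewrite sqrtr_gt0 divr_gt0.
have Delta1 : Delta <= 1.
  by rewrite -[leRHS]sqrtr1 ler_sqrt //; lra.
pose q0 := kap / 4 * Delta; have q00 : 0 < q0 by rewrite !mulr_gt0 ?invr_gt0.
have q01 : q0 <= 1 by rewrite /q0 mulr_ile1 ?(ltW Delta0) //; lra.
pose h := (Num.truncn (10 * ln k%:R / q0)).+1.
have h_lo : 10 * ln k%:R <= h%:R * q0.
  by rewrite -ler_pdivrMr // ltW // truncnS_gt.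
have h_hi : h%:R * q0 <= 12 * ln k%:R.
  have /truncn_itv/andP[t _] : 0 <= 10 * ln k%:R / q0 by rewrite divr_ge0 ?(ltW q00) //; lra.
  rewrite /h -natr1 mulrDl mul1r; move: t; rewrite ler_pdivlMr //; lra.
clearbody h.
pose P := @prodp R Om p h; pose H := @hash V Om B h.
have P0 om : 0 <= P om by apply: prodp_ge0.
pose coll om := \sum_u \sum_(v | far f eps u v && (H om u == H om v)) mass (wdeg E w) f u * mass (wdeg E w) f v.
have m0 v : 0 <= mass (wdeg E w) f v by apply: mass_ge0.
have coll0 om : 0 <= coll om by rewrite sumr_ge0 // => u _; rewrite sumr_ge0 // => v _; rewrite mulr_ge0.
have Ecoll : \sum_om P om * coll om <= eps / 64.
  have pc u v : far f eps u v -> \sum_(om | H om u == H om v) P om <= k%:R ^- 10.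
    move=> uv; rewrite /H /P prob_hash_collision //.
    set s := \sum_(o | _) p o; have s1 : s <= 1.
      by rewrite /s -p1 [leLHS]big_mkcond; apply: ler_sum => o _; case: ifP.
    have sq : q0 <= s.
      apply: le_trans (Hsep u v); rewrite ler_pM2l ?divr_gt0 // ler_sqrt //; exact: sqdist_ge0.
    apply: (@le_trans _ _ (expR (- (h%:R * q0)))).
      have -> : expR (- (h%:R * q0)) = expR (- q0) ^+ h by rewrite -expRM_natl mulrN.
      apply: lerXn2r; rewrite ?nnegrE ?expR_ge0 ?subr_ge0 //.
      by have := expR_ge1Dx (- q0); lra.
    apply: (@le_trans _ _ (expR (- (10 * ln k%:R)))); first by rewrite ler_expR lerN2.
    by rewrite expRN expRM_natl lnK.
  have -> : \sum_om P om * coll om = \sum_u \sum_(v | far f eps u v)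
      mass (wdeg E w) f u * mass (wdeg E w) f v * \sum_(om | H om u == H om v) P om.
    rewrite /coll; under eq_bigr do rewrite mulr_sumr.
    rewrite exchange_big; apply: eq_bigr => u _ /=.
    under eq_bigr do rewrite mulr_sumr big_mkcondr.
    rewrite exchange_big; apply: eq_bigr => v _ /=.
    rewrite mulr_sumr [RHS]big_mkcond; apply: eq_bigr => om _.
    by rewrite mulrC.
  apply: (@le_trans _ _ (\sum_u \sum_v mass (wdeg E w) f u * mass (wdeg E w) f v * k%:R ^- 10)).
    apply: ler_sum => u _; rewrite big_mkcond; apply: ler_sum => v _; case: ifP => [uv|_].
      by apply: ler_wpM2l; [rewrite mulr_ge0 | apply: pc].
    by rewrite divr_ge0 ?exprn_ge0 // mulr_ge0.
  have sm : \sum_v mass (wdeg E w) f v = k%:R by rewrite -f_iso.1.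
  under eq_bigr do rewrite -mulr_suml -mulr_sumr sm.
  rewrite -!mulr_suml sm -expr2 ler_pdivrMr ?exprn_gt0 //.
  have k2 : 2 <= k%:R :> R by rewrite ler_nat.
  have : 1 <= 2 * k%:R * eps by rewrite -ler_pdivrMl ?mulr_gt0 // mulr1.
  have : 2 ^+ 7 <= k%:R ^+ 7 :> R by rewrite ler_pXn2r ?nnegrE.
  have -> : 2 ^+ 7 = 128 :> R by ring.
  have -> : eps / 64 * k%:R ^+ 10 = k%:R ^+ 2 * (k%:R ^+ 7 * (k%:R * eps) / 64) by field.
  move=> k7 ke; rewrite ler_peMr ?exprn_ge0 //; nra.
have Eshort : \sum_om P om * short_cost (H om) <= short_bound.
  have Xhp e : e \in E -> 0 < peak e ->
      h%:R * (\sum_(o | splits (B o) e) p o) <= X * Num.sqrt (D e) / peak e.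
    move=> eE pk.
    have Hp : \sum_(o | splits (B o) e) p o <= kap * (8 * Num.sqrt (ln r%:R) * (4 * Num.sqrt (D e) / peak e)).
      apply: Hsplit; rewrite ?rank_le // ?divr_ge0 ?mulr_ge0 ?sqrtr_ge0 ?(ltW pk) // => u v ue ve.
      have [x [xe xpk xmax]] := peakP ue; rewrite -xpk.
      by apply: (sqdist_direction_edge (e := e)); rewrite ?xpk // => ? ? ? ?; apply: f_D.
    apply: le_trans (ler_wpM2l (ler0n _ h) Hp) _.
    have -> : h%:R * (kap * (8 * Num.sqrt (ln r%:R) * (4 * Num.sqrt (D e) / peak e))) =
      h%:R * q0 * (128 * Num.sqrt (ln r%:R) * Num.sqrt (D e) / peak e / Delta).
      by rewrite /q0; field; rewrite !gt_eqF.
    have -> : X * Num.sqrt (D e) / peak e =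
        12 * ln k%:R * (128 * Num.sqrt (ln r%:R) * Num.sqrt (D e) / peak e / Delta).
      by rewrite /hash_rate -/Delta; field; rewrite !gt_eqF.
    apply: ler_wpM2r => //.
    by rewrite !mulr_ge0 ?invr_ge0 ?sqrtr_ge0 ?(ltW pk).
  pose term e : R := (2 + 4 * X) * (w e * (Num.sqrt (D e) * peak e)).
  apply: (@le_trans _ _ (\sum_(e in E | short e) term e)).
    rewrite /short_cost; under eq_bigr do rewrite mulr_sumr.
    rewrite exchange_big /=; apply: ler_sum => e /andP[eE se].
    under eq_bigr do rewrite mulrCA.
    rewrite -mulr_sumr /term mulrCA; apply: ler_wpM2l; first exact: w_ge0.
    have [pk0|pk0] := eqVneq (peak e) 0.
      by rewrite big1 ?pk0 ?mulr0 // => om _; rewrite expr0n !mulr0 addr0 mulr0.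
    have pk : 0 < peak e by rewrite lt_def pk0 peak_ge0.
    have -> : \sum_om P om * (2 * Num.sqrt (D e) * peak e + 2 * (#|H om @: e|%:R - 1) * peak e ^+ 2) =
      2 * Num.sqrt (D e) * peak e * \sum_om P om
      + 2 * peak e ^+ 2 * (\sum_om P om * #|H om @: e|%:R - \sum_om P om).
      by rewrite -sumrB !mulr_sumr -big_split; apply: eq_bigr => om _ /=; ring.
    have -> : \sum_om P om = 1 by apply: sum_prodp1.
    have := expected_cells B h p0 p1 e; rewrite -/P -/H => HE.
    have pe0 : 0 <= \sum_(o | splits (B o) e) p o by apply: sumr_ge0.
    have Xpe := Xhp e eE pk.
    have sh : X * Num.sqrt (D e) / peak e <= 2^-1 by rewrite ler_pdivrMr // [leRHS]mulrC; exact: se.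
    have := le_trans HE (expr1D_le pe0 (le_trans Xpe sh)).
    move: Xpe; set y := h%:R * _; set N := \sum_om _ => Xpe HN.
    have HN2 : 2 * peak e ^+ 2 * (N - 1) <= 2 * peak e ^+ 2 * (2 * (X * Num.sqrt (D e) / peak e)).
      by apply: ler_wpM2l; [rewrite mulr_ge0 // sqr_ge0 | lra].
    have E2 : 2 * peak e ^+ 2 * (2 * (X * Num.sqrt (D e) / peak e)) = 4 * X * (Num.sqrt (D e) * peak e).
      by field; rewrite gt_eqF.
    by move: HN2; rewrite E2; lra.
  apply: (@le_trans _ _ (\sum_(e in E) term e)).
    rewrite big_mkcondr; apply: ler_sum => e eE; case: ifP => // _.
    have := hash_rate_gt0 => X0.
    by rewrite !mulr_ge0 ?w_ge0 ?sqrtr_ge0 ?peak_ge0 //; lra.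
  rewrite -mulr_sumr ler_wpM2l ?sum_w_D_peak //.
  by have := hash_rate_gt0; lra.
have Ts := short_bound_gt0.
have [om /andP[oms omc]] : exists om, (short_cost (H om) <= 2 * short_bound) && (coll om <= eps / 32).
  apply/existsP; apply: contraT; rewrite negb_exists => /forallP no.
  have sc0 om : 0 <= short_cost (H om).
    apply: sumr_ge0 => e /andP[eE _]; rewrite mulr_ge0 ?w_ge0 // addr_ge0 //.
      by rewrite !mulr_ge0 ?sqrtr_ge0 ?peak_ge0.
    have [->|[u ue]] := set_0Vmem e; first by rewrite peak0 expr0n mulr0.
    rewrite mulr_ge0 ?sqr_ge0 // mulr_ge0 // subr_ge0 ler1n.
    by apply/card_gt0P; exists (H om u); apply: imset_f.
  pose F om := short_cost (H om) / short_bound + coll om * (64 / eps).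
  have F2 om : 2 < F om.
    have c0 : 0 <= coll om * (64 / eps) by rewrite mulr_ge0 // divr_ge0 // ltW.
    have s0 : 0 <= short_cost (H om) / short_bound by rewrite divr_ge0 // ltW.
    have := no om; rewrite negb_and -!ltNge => /orP[h1|h1]; rewrite /F.
      have : 2 < short_cost (H om) / short_bound by rewrite ltr_pdivlMr.
      lra.
    have : 2 < coll om * (64 / eps).
      have -> : 2 = eps / 32 * (64 / eps) by field; rewrite gt_eqF.
      by rewrite ltr_pM2r // divr_gt0.
    lra.
  have : \sum_om P om * F om <= 2.
    have -> : \sum_om P om * F om = (\sum_om P om * short_cost (H om)) / short_bound +
       (\sum_om P om * coll om) * (64 / eps).
      by rewrite !mulr_suml -big_split; apply: eq_bigr => om _; rewrite /F /= mulrDr !mulrA.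
    have h1 : (\sum_om P om * short_cost (H om)) / short_bound <= 1 by rewrite ler_pdivrMr // mul1r.
    have : (\sum_om P om * coll om) * (64 / eps) <= eps / 64 * (64 / eps).
      by rewrite ler_pM2r // divr_gt0.
    have -> : eps / 64 * (64 / eps) = 1 by field; rewrite gt_eqF.
    lra.
  have P1 : \sum_om P om = 1 by apply: sum_prodp1.
  move=> Hle2; have Hle : \sum_om (P om * F om - 2 * P om) <= 0.
    by rewrite sumrB -mulr_sumr P1 mulr1 subr_le0.
  have pos om : 0 <= P om * F om - 2 * P om.
    by rewrite mulrC -mulrBl mulr_ge0 // subr_ge0 ltW.
  have /psumr_eq0P Z : \sum_om (P om * F om - 2 * P om) = 0.
    by apply/eqP; rewrite eq_le Hle sumr_ge0.
  have P00 om : P om = 0.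
    have /eqP := Z (fun om _ => pos om) om isT; rewrite mulrC -mulrBl mulf_eq0.
    by rewrite subr_eq0 gt_eqF //= => /eqP.
  by move/eqP: P1; rewrite big1 ?(eq_sym 0) ?oner_eq0.
exists {ffun 'I_h -> bool}, (H om); split=> // c.
rewrite (eq_bigl (fun v => v \in [set v | H om v == c])) => [|v]; last by rewrite inE.
apply: (cell_mass_le wdeg_gt0 f_iso eps0 eps_le1 _ omc).
rewrite /coll big_mkcond; apply: ler_sum => u _; case: ifP => [|_]; last first.
  by rewrite sumr_ge0 // => v _; rewrite mulr_ge0.
rewrite inE => /eqP uc; rewrite big_mkcond [leRHS]big_mkcond; apply: ler_sum => v _.
rewrite inE uc [c == _]eq_sym; case: (_ == c) => /=; rewrite ?andbT ?andbF //.
Qed.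
End GoodHash.

Section SparseSets.
Variables (R : realType) (V I : finType) (E : {set {set V}}) (w : {set V} -> R).
Variables (k r : nat) (f : V -> I -> R) (D : {set V} -> R) (eps sigma : R).
Hypothesis w_ge0 : forall e, e \in E -> 0 <= w e.
Hypothesis wdeg_gt0 : forall v, 0 < wdeg E w v.
Hypotheses (k_ge2 : (2 <= k)%N) (r_ge2 : (2 <= r)%N).
Hypothesis rank_le : forall e, e \in E -> (#|e| <= r)%N.
Hypothesis f_iso : sub_isotropic (wdeg E w) k%:R f.
Hypothesis D_ge0 : forall e, e \in E -> 0 <= D e.
Hypothesis f_D : forall e u v, e \in E -> u \in e -> v \in e -> sqdist f u v <= D e.
Hypotheses (sigma_gt0 : 0 < sigma) (sum_D : \sum_(e in E) w e * D e <= sigma).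
Hypotheses (eps_lo : (2 * k%:R)^-1 <= eps) (eps_le1 : eps <= 1).

Local Notation X := (hash_rate k r eps).
Local Notation vmass := (mass (wdeg E w) f).
Local Notation m v := (dotp f v v).

Definition total_cost : R := 2 * short_bound k r eps sigma + 16 * k%:R * X ^+ 2 * sigma.
Definition cost_cutoff : R := 8 * total_cost / (3 * eps * k%:R).

Let k0 : 0 < k%:R :> R. Proof. by rewrite ltr0n (leq_trans _ k_ge2). Qed.
Let eps0 : 0 < eps. Proof. by apply: lt_le_trans eps_lo; rewrite invr_gt0 mulr_gt0. Qed.

Let rate2_ge0 : 0 <= 16 * k%:R * X ^+ 2.
Proof. by rewrite mulr_ge0 ?sqr_ge0 // mulr_ge0 // ltW. Qed.

Lemma total_cost_gt0 : 0 < total_cost.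
Proof.
have s0 := short_bound_gt0 k_ge2 r_ge2 sigma_gt0 eps_lo.
apply: ltr_pwDl; first by rewrite mulr_gt0.
by rewrite mulr_ge0 ?rate2_ge0 ?(ltW sigma_gt0).
Qed.

Lemma boundary_splits (S : {set V}) (F : {set V} -> R) :
  \sum_(e in boundary E S) F e = \sum_(e in E | splits S e) F e.
Proof. by apply: eq_bigl => e; rewrite inE /splits finset.setDE. Qed.

Lemma wvol_gt0 (S : {set V}) : S != finset.set0 -> 0 < wvol E w S.
Proof.
case/set0Pn => v vS; rewrite /wvol (bigD1 v) //= ltr_pwDl ?wdeg_gt0 // sumr_ge0 // => u _.
exact: ltW.
Qed.

Lemma level_set_sparse (lev om : option V -> R) (Q : {set V}) :
  (forall t, 0 <= om t) -> (forall v, \sum_(t | lev t < m v) om t = m v) ->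
  4^-1 <= \sum_(v in Q) vmass v ->
  \sum_(e in E) w e * level_cost (fun v => m v) lev om Q e <= cost_cutoff ->
  exists t, level_set (fun v => m v) lev Q t != finset.set0 /\
    \sum_(e in boundary E (level_set (fun v => m v) lev Q t)) w e <=
      4 * cost_cutoff * wvol E w (level_set (fun v => m v) lev Q t).
Proof.
move=> om0 omE Qmass cost.
pose S t := level_set (fun v => m v) lev Q t.
have costE : \sum_(e in E) w e * level_cost (fun v => m v) lev om Q e =
    \sum_t om t * \sum_(e in boundary E (S t)) w e.
  under [RHS]eq_bigr do rewrite boundary_splits mulr_sumr.
  under [LHS]eq_bigr do rewrite /level_cost mulr_sumr.
  rewrite (exchange_big_dep xpredT) //=; apply: eq_bigr => t _.
  by apply: eq_bigr => e _; rewrite mulrC.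
have massE : \sum_(v in Q) vmass v = \sum_t om t * wvol E w (S t).
  rewrite /wvol; under [RHS]eq_bigr do rewrite mulr_sumr.
  rewrite (exchange_big_dep (fun v => v \in Q)) /=; last by move=> t v _; rewrite inE => /andP[].
  apply: eq_bigr => v vQ; rewrite /mass -{1}omE mulr_sumr.
  rewrite [LHS]big_mkcond [RHS]big_mkcond; apply: eq_bigr => t _.
  by rewrite inE vQ /= mulrC.
have c0 : 0 <= cost_cutoff.
  by rewrite divr_ge0 ?mulr_ge0 ?(ltW eps0) ?(ltW k0) // ltW // total_cost_gt0.
suff [t [tS tle]] : exists t, S t != finset.set0 /\ \sum_(e in boundary E (S t)) w e <=
    4 * cost_cutoff * wvol E w (S t) by exists t.
apply: contrapT => /forallNP no.
have lt t : S t != finset.set0 -> 4 * cost_cutoff * wvol E w (S t) < \sum_(e in boundary E (S t)) w e.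
  by move=> tS; rewrite ltNge; apply/negP => h; apply: (no t).
have pos t : 0 <= om t * (\sum_(e in boundary E (S t)) w e - 4 * cost_cutoff * wvol E w (S t)).
  rewrite mulr_ge0 // subr_ge0; have [->|/lt/ltW //] := eqVneq (S t) finset.set0.
  rewrite /wvol big_set0 mulr0 sumr_ge0 // => e; rewrite inE => /andP[eE _]; exact: w_ge0.
have sum0 : \sum_t om t * (\sum_(e in boundary E (S t)) w e - 4 * cost_cutoff * wvol E w (S t)) = 0.
  apply/eqP; rewrite eq_le sumr_ge0 // andbT.
  under eq_bigr do rewrite mulrBr mulrCA.
  rewrite sumrB -costE -mulr_sumr -massE subr_le0; apply: le_trans cost _.
  by rewrite mulrAC ler_peMl // -ler_pdivrMl // mulr1.
have om_vol t : om t * wvol E w (S t) = 0.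
  have [->|St] := eqVneq (S t) finset.set0; first by rewrite /wvol big_set0 mulr0.
  have /eqP := psumr_eq0P (fun t _ => pos t) sum0 (i := t) isT.
  by rewrite mulf_eq0 subr_eq0 (gt_eqF (lt t St)) orbF => /eqP->; rewrite mul0r.
by move: Qmass; rewrite massE big1 // leNgt invr_gt0 ltr0n.
Qed.

Lemma sparse_sets : exists (g : nat) (S : 'I_g -> {set V}),
  [/\ (1 - eps) * k%:R <= g%:R, forall i, S i != finset.set0,
    forall i j, i != j -> [disjoint S i & S j] &
    forall i, \sum_(e in boundary E (S i)) w e <= 4 * cost_cutoff * wvol E w (S i)].
Proof.
have e1 := eps_le1; have e0 := eps0; have kp := k0.
have [T [H [Hmass Hshort]]] := good_hash w_ge0 wdeg_gt0 k_ge2 r_ge2 rank_le f_iso D_ge0 f_D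
  sigma_gt0 sum_D eps_lo eps_le1.
pose mu c := \sum_(v | H v == c) vmass v.
have mass0 v : 0 <= vmass v by apply: mass_ge0.
have mu0 c : 0 <= mu c by apply: sumr_ge0.
have a1 : 1 <= 1 + eps / 8 by lra.
have [n [G [G4 Gdisj Gsum]]] := merge_light mu0 Hmass a1.
have [lev [om [om0 omE ombtw]]] := level_weights (fun v => dotp_ge0 f v).
have muG i : \sum_(c in G i) mu c = \sum_(v in group_set H G i) vmass v.
  rewrite (partition_big H (fun c => c \in G i)) => [|v] /=; last by rewrite inE.
  apply: eq_bigr => c cG; apply: eq_bigl => v; rewrite inE.
  by case: eqP => [->|_]; rewrite ?cG ?andbT ?andbF.
have mu_tot : \sum_c mu c = k%:R.
  by rewrite -f_iso.1 (partition_big H xpredT).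
have n4k : n%:R <= 4 * k%:R :> R.
  have : \sum_(i < n) (4^-1 : R) <= k%:R.
    rewrite -mu_tot; apply: (@le_trans _ _ (\sum_(i < n) \sum_(c in G i) mu c)).
      by apply: ler_sum => i _; apply: G4.
    rewrite (exchange_big_dep xpredT) //=; apply: ler_sum => c _.
    case: (pickP (fun i => c \in G i)) => [i0 ci0|c0]; last by rewrite big_pred0.
    rewrite (bigD1 i0) //= big1 ?addr0 // => i /andP[ci /Gdisj].
    by rewrite disjoint_sym => /disjointFr/(_ ci0); rewrite ci.
  rewrite sumr_const card_ord -mulr_natr; lra.
pose cost i := \sum_(e in E) w e * level_cost (fun v => m v) lev om (group_set H G i) e.
have cost0 i : 0 <= cost i.
  by apply: sumr_ge0 => e eE; rewrite mulr_ge0 ?w_ge0 // level_cost_ge0.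
have cost_sum : \sum_i cost i <= total_cost.
  have step e : e \in E -> \sum_i level_cost (fun v => m v) lev om (group_set H G i) e <=
     if X * Num.sqrt (D e) <= peak f e / 2 then
       2 * Num.sqrt (D e) * peak f e + 2 * (#|H @: e|%:R - 1) * peak f e ^+ 2
     else 16 * k%:R * X ^+ 2 * D e.
    move=> eE; have [e0'|[u ue]] := set_0Vmem e.
      rewrite big1 => [|i _]; last by apply: level_cost_untouched; rewrite -setI_eq0 e0' finset.set0I.
      rewrite e0' peak0 expr0n !mulr0 addr0; case: ifP => // _.
      by rewrite mulr_ge0 ?rate2_ge0 // -e0' D_ge0.
    have [x [xe xpk xmax]] := peakP f ue.
    have m_le v : v \in e -> m v <= m x.
      by move=> ve; rewrite -!sqr_enorm xpk ler_sqr ?nnegrE ?enorm_ge0 ?peak_ge0 // xmax.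
    have mx : m x = peak f e ^+ 2 by rewrite -xpk sqr_enorm.
    case: ifP => [_|/negbT lng].
      case: (arg_minP (fun v => m v) ue) => y ye ymin.
      apply: (le_trans (group_cost_le (fun v => dotp_ge0 f v) om0 omE ombtw H Gdisj xe ye _)).
        by move=> v ve; rewrite m_le // ymin.
      rewrite mx; apply: lerD => //; rewrite -mx -xpk.
      by apply: sqr_enormB_edge; rewrite ?D_ge0 ?xpk ?xmax ?f_D.
    apply: (le_trans (group_cost_le_card om0 omE H G xe m_le)); rewrite mx.
    have pk_le : peak f e ^+ 2 <= 4 * X ^+ 2 * D e.
      have {lng} : peak f e <= 2 * (X * Num.sqrt (D e)).
        by rewrite -ltNge in lng; rewrite -ler_pdivrMl // mulrC ltW.
      have X0 := hash_rate_gt0 k_ge2 r_ge2 eps_lo.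
      rewrite -ler_sqr ?nnegrE ?peak_ge0 //; last first.
        by apply: mulr_ge0 => //; apply: mulr_ge0; [apply: ltW | apply: sqrtr_ge0].
      have -> : (2 * (X * Num.sqrt (D e))) ^+ 2 = 4 * X ^+ 2 * Num.sqrt (D e) ^+ 2 by ring.
      by rewrite sqr_sqrtr ?D_ge0.
    apply: (@le_trans _ _ (4 * k%:R * peak f e ^+ 2)).
      by rewrite ler_wpM2r ?sqr_ge0.
    have -> : 16 * k%:R * X ^+ 2 * D e = 4 * k%:R * (4 * X ^+ 2 * D e) by ring.
    by rewrite ler_wpM2l // mulr_ge0 // ltW.
  rewrite /cost exchange_big /=.
  apply: (@le_trans _ _ (short_cost E w k r f D eps H + \sum_(e in E) 16 * k%:R * X ^+ 2 * (w e * D e))).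
    rewrite /short_cost big_mkcondr -big_split /=; apply: ler_sum => e eE.
    rewrite -mulr_sumr; apply: (le_trans (ler_wpM2l (w_ge0 eE) (step e eE))).
    rewrite /short; case: ifP => _.
      by rewrite lerDl mulr_ge0 ?rate2_ge0 // mulr_ge0 ?w_ge0 ?D_ge0.
    by rewrite add0r mulrCA.
  rewrite -mulr_sumr; apply: lerD => //.
  by rewrite ler_wpM2l ?rate2_ge0.
pose good := [set i | cost i <= cost_cutoff].
have cc0 : 0 < cost_cutoff by rewrite divr_gt0 ?mulr_gt0 // total_cost_gt0.
have bad_le : #|~: good|%:R <= 3 * eps * k%:R / 8.
  have : #|~: good|%:R * cost_cutoff <= total_cost.
    apply: le_trans cost_sum; rewrite mulr_natl -sumr_const [leLHS]big_mkcond.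
    by apply: ler_sum => i _; rewrite !inE -ltNge; case: ifP => // /ltW.
  rewrite /cost_cutoff mulrA ler_pdivrMr ?mulr_gt0 // => h.
  have T0 := total_cost_gt0.
  by rewrite -(ler_pM2r T0); lra.
have good_ge : (1 - eps) * k%:R <= #|good|%:R.
  have := cardsC good; rewrite card_ord => /(congr1 (fun x => x%:R : R)); rewrite natrD => gE.
  have kn : k%:R <= n%:R * (1 + eps / 8) + 4^-1 by rewrite -mu_tot.
  have : 1 <= 2 * k%:R * eps by rewrite -ler_pdivrMl ?mulr_gt0 // mulr1.
  nra.
have /boolp.choice[t Ht] i : exists t, i \in good -> level_set (fun v => m v) lev (group_set H G i) t != finset.set0 /\
    \sum_(e in boundary E (level_set (fun v => m v) lev (group_set H G i) t)) w e <=
      4 * cost_cutoff * wvol E w (level_set (fun v => m v) lev (group_set H G i) t).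
  have [ig|_] := boolP (i \in good); last by exists None.
  have h1 : 4^-1 <= \sum_(v in group_set H G i) vmass v by rewrite -muG G4.
  have h2 : cost i <= cost_cutoff by rewrite inE in ig.
  by have [t Ht] := level_set_sparse om0 omE h1 h2; exists t.
exists #|good|, (fun j => level_set (fun v => m v) lev (group_set H G (enum_val j)) (t (enum_val j))).
split=> // [j|j j' jj'|j].
- by have [] := Ht _ (enum_valP j).
- have /Gdisj : enum_val j != enum_val j' by rewrite (inj_eq enum_val_inj).
  rewrite -!setI_eq0 => /eqP/setP GG.
  apply/eqP/setP => v; rewrite !inE; have := GG (H v); rewrite !inE.
  by case: (H v \in G _) => //=; case: (H v \in G _); rewrite ?andbF.
- by have [] := Ht _ (enum_valP j).
Qed.
End SparseSets.

(** * Conductance *)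

Section Conductance.
Variables (R : realType) (V : finType) (E : {set {set V}}) (w : {set V} -> R).
Hypothesis w_ge0 : forall e, e \in E -> 0 <= w e.
Hypothesis wdeg_gt0 : forall v, 0 < wdeg E w v.
Implicit Types S : {set V}.

Local Notation cut S := (\sum_(e in boundary E S) w e).

Lemma cut_ge0 S : 0 <= cut S.
Proof. by apply: sumr_ge0 => e; rewrite inE => /andP[eE _]; apply: w_ge0. Qed.

Lemma boundaryC S : boundary E (~: S) = boundary E S.
Proof. by apply/setP => e; rewrite !inE finset.setCK [(_ != _) && (_ != _)]andbC. Qed.

Lemma cut_le_wvol S : cut S <= wvol E w S.
Proof.
rewrite /wvol /wdeg (exchange_big_dep (fun e => e \in E)) /=; last by move=> v e _ /andP[].
rewrite big_mkcond [leRHS]big_mkcond; apply: ler_sum => e _.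
rewrite inE; case: ifP => [/and3P[eE /set0Pn[u]] + _|_].
  rewrite inE eE => /andP[ue uS].
  rewrite (bigD1 u) /= ?uS // lerDl sumr_ge0 // => *; exact: w_ge0.
by case: ifP => // eE; apply: sumr_ge0 => *; apply: w_ge0.
Qed.

Lemma wvol_ge0 S : 0 <= wvol E w S.
Proof. by apply: sumr_ge0 => v _; apply: ltW. Qed.

Lemma conductance_le1 S : conductance E w S <= 1.
Proof.
have m0 : 0 <= Num.min (wvol E w S) (wvol E w (~: S)) by rewrite le_min !wvol_ge0.
rewrite /conductance; set mn := Num.min _ _ in m0 *.
have [->|mn0] := eqVneq mn 0; first by rewrite invr0 mulr0.
by rewrite ler_pdivrMr ?lt_def ?mn0 // mul1r le_min cut_le_wvol -boundaryC cut_le_wvol.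
Qed.

Lemma conductance_le S (b : R) : S != finset.set0 -> S != finset.setT ->
  cut S <= b * wvol E w S -> cut S <= b * wvol E w (~: S) -> conductance E w S <= b.
Proof.
move=> S0 ST b1 b2; rewrite ler_pdivrMr; first by rewrite minEle; case: ifP.
rewrite lt_min !wvol_gt0 //.
by apply: contraNneq ST => SC; rewrite -(finset.setCK S) SC finset.setC0.
Qed.

Lemma cut_bigcup (I : finType) (P : pred I) (S : I -> {set V}) :
  cut (\bigcup_(i | P i) S i) <= \sum_(i | P i) cut (S i).
Proof.
rewrite [leRHS](exchange_big_dep (fun e => e \in E)) /=; last by move=> i e _; rewrite inE => /andP[].
rewrite big_mkcond [leRHS]big_mkcond; apply: ler_sum => e _.
rewrite inE; case: ifP => [/and3P[eE /set0Pn[u]] + /set0Pn[v]|_]; last first.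
  by case: ifP => // eE; apply: sumr_ge0 => *; apply: w_ge0.
rewrite eE !inE => /andP[ue /bigcupP[i Pi ui]] /andP[ve vn].
rewrite (bigD1 i) /=; last first.
  rewrite Pi inE eE /=; apply/andP; split; apply/set0Pn; [exists u|exists v]; rewrite !inE ?ue ?ve //=.
  by apply: contra vn => vi; apply/bigcupP; exists i.
by rewrite lerDl sumr_ge0 // => *; apply: w_ge0.
Qed.

(* A set of volume more than one half is replaced by the complement of the union of the others. *)
Lemma disjoint_sparse_kway (g : nat) (S : 'I_g -> {set V}) (b : R) : (2 <= g)%N -> 0 <= b ->
  (forall i, S i != finset.set0) -> (forall i j, i != j -> [disjoint S i & S j]) ->
  (forall i, cut (S i) <= b * wvol E w (S i)) ->
  exists2 S' : 'I_g -> {set V}, kway_family S' & forall i, conductance E w (S' i) <= b.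
Proof.
move=> g2 b0 S0 Sd Sb.
have wvolS (A B : {set V}) : A \subset B -> wvol E w A <= wvol E w B.
  move=> AB; rewrite /wvol [leRHS](big_setID A) /= (finset.setIidPr AB) lerDl.
  by apply: sumr_ge0 => v _; apply: ltW.
have other i : exists j : 'I_g, j != i.
  have /card_gt0P[j] : (0 < #|[set~ i]|)%N by rewrite cardsC1 card_ord -ltnS prednK // ltnW.
  by rewrite !inE => ji; exists j.
have ST i : S i != finset.setT.
  have [j ji] := other i; apply: contraTneq (S0 j) => iT.
  by have := Sd _ _ ji; rewrite iT -setI_eq0 finset.setIT negbK.
case: (pickP (fun i => wvol E w (~: S i) < wvol E w (S i))) => [i0 big0|small]; last first.
  exists S => // i; apply: conductance_le => //; apply: le_trans (Sb i) _.
  by rewrite ler_wpM2l // leNgt small.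
pose U := \bigcup_(j | j != i0) S j.
have USi0 : U \subset ~: S i0.
  by apply/bigcupsP => j ji0; rewrite -finset.disjoints_subset Sd.
have SU j : j != i0 -> S j \subset U by move=> ji0; apply: (bigcup_max j).
exists (fun i => if i == i0 then ~: U else S i).
  split=> [i|i j ij].
    case: (eqVneq i i0) => // _; split.
      by apply: contraNneq (S0 i0) => UC; rewrite -finset.subset0 -UC finset.subsetC.
    have [j ji] := other i0; apply: contraNneq (S0 j) => UC.
    by rewrite -finset.subset0 -finset.setCT -UC finset.setCK SU.
  have dis j' : j' != i0 -> [disjoint ~: U & S j'].
    by move=> ji; rewrite disjoint_sym finset.disjoints_subset finset.setCK SU.
  case: (eqVneq i i0) => [ii|ii]; case: (eqVneq j i0) => [jj|jj].
  - by rewrite ii jj eqxx in ij.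
  - exact: dis.
  - by rewrite disjoint_sym; apply: dis.
  - exact: Sd.
move=> i; case: eqP => [_|/eqP ii0].
  have cutU : cut (~: U) <= b * wvol E w U.
    rewrite boundaryC; apply: le_trans (cut_bigcup _ _) _.
    apply: (@le_trans _ _ (\sum_(j | j != i0) b * wvol E w (S j))); first exact: ler_sum.
    rewrite -mulr_sumr /U big_mkcond [X in wvol E w X]big_mkcond /wvol partition_disjoint_bigcup.
      by rewrite ler_wpM2l //; apply: ler_sum => j _; case: ifP; rewrite ?big_set0.
    move=> j j' jj; case: (j != i0); last by rewrite -setI_eq0 finset.set0I.
    by case: (j' != i0); [apply: Sd | rewrite -setI_eq0 finset.setI0].
  apply: conductance_le; rewrite ?finset.setCK //.
  - by apply: contraNneq (S0 i0) => UC; rewrite -finset.subset0 -UC finset.subsetC.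
  - have [j ji] := other i0; apply: contraNneq (S0 j) => UC.
    by rewrite -finset.subset0 -finset.setCT -UC finset.setCK SU.
  - apply: (le_trans cutU); rewrite ler_wpM2l //.
    apply: (le_trans (wvolS _ _ USi0)); apply: (le_trans (ltW big0)); apply: wvolS.
    by rewrite finset.subsetC.
apply: conductance_le => //; apply: (le_trans (Sb i)); rewrite ler_wpM2l //.
have d := Sd _ _ ii0.
apply: (@le_trans _ _ (wvol E w (~: S i0))); first by apply: wvolS; rewrite -finset.disjoints_subset.
apply: (le_trans (ltW big0)); apply: wvolS; by rewrite -finset.disjoints_subset disjoint_sym.
Qed.

Lemma kway_conductance_le (k g : nat) (S : 'I_g -> {set V}) (b : R) : (k <= g)%N -> 0 <= b ->
  kway_family S -> (forall i, conductance E w (S i) <= b) -> kway_conductance E w k <= b.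
Proof.
move=> kg b0 [S0 Sd] Sb.
apply: (@le_trans _ _ (\big[Num.max/0]_(i < k) conductance E w (S (widen_ord kg i)))).
  apply: inf_lbound; last first.
    exists (fun i => S (widen_ord kg i)) => //; split=> [i|i j ij]; first exact: S0.
    by apply: Sd; apply: contra ij => /eqP/(congr1 val)/= ij; apply/eqP/val_inj.
  exists 0 => _ [S' _ ->]; exact: bigmax_ge_id.
by apply/bigmax_leP; split.
Qed.

Lemma singleton_family (k : nat) : (2 <= #|V|)%N -> (k <= #|V|)%N ->
  exists2 S : 'I_k -> {set V}, kway_family S & forall i, exists v, S i = [set v].
Proof.
move=> V2 kV; exists (fun i => [set enum_val (widen_ord kV i)]); last by move=> i; eexists.
split=> [i|i j ij].
  split; first by apply/set0Pn; exists (enum_val (widen_ord kV i)); rewrite inE.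
  by apply: contraTneq V2 => E1; rewrite -cardsT -E1 cards1.
rewrite disjoints1 inE (inj_eq enum_val_inj); apply: contra ij => /eqP/(congr1 val)/= ij.
by apply/eqP/val_inj.
Qed.

Lemma kway_conductance_le1 (k : nat) : (2 <= #|V|)%N -> (k <= #|V|)%N -> kway_conductance E w k <= 1.
Proof.
move=> V2 kV; have [S Sk _] := singleton_family V2 kV.
by apply: (kway_conductance_le (leqnn k) _ Sk) => // i; apply: conductance_le1.
Qed.

Lemma kway_conductance_trivial (k : nat) : (2 <= #|V|)%N -> (k <= #|V|)%N ->
  (forall e, e \in E -> (#|e| <= 1)%N) -> kway_conductance E w k <= 0.
Proof.
move=> V2 kV E1; have [S Sk _] := singleton_family V2 kV.
apply: (kway_conductance_le (leqnn k) _ Sk) => // i.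
rewrite /conductance big1 ?mul0r // => e; rewrite inE => /and3P[eE /set0Pn[u] + /set0Pn[v]].
rewrite !inE => /andP[ue uS] /andP[ve vS].
have /fintype.card_le1_eqP/(_ u v ue ve) uv := E1 e eE.
by rewrite uv uS in vS.
Qed.

Lemma le_kway_conductance (k : nat) (b : R) : (2 <= #|V|)%N -> (k <= #|V|)%N ->
  (forall S : 'I_k -> {set V}, kway_family S -> b <= \big[Num.max/0]_(i < k) conductance E w (S i)) ->
  b <= kway_conductance E w k.
Proof.
move=> V2 kV H; have [S Sk _] := singleton_family V2 kV.
apply: lb_le_inf; first by eexists; exists S.
by move=> _ [S' Sk' ->]; apply: H.
Qed.

Lemma sum_smallest_le_conductance (k : nat) c (S : 'I_k -> {set V}) : (0 < k <= #|V|)%N ->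
  feasible E w c -> kway_family S ->
  sum_smallest_eigenvalues k (nlaplacian E w c) <= \sum_i conductance E w (S i).
Proof.
move=> /andP[k0 kV] cfeas [S0 Sd].
have volS i : 0 < wvol E w (S i) by apply: wvol_gt0; case: (S0 i).
pose X : 'M[R]_(k, #|V|) := \matrix_(i, j)
  (Num.sqrt (wdeg E w (enum_val j)) * (enum_val j \in S i)%:R / Num.sqrt (wvol E w (S i))).
have XX : X *m X^T = 1%:M.
  apply/matrixP => i i'; rewrite !mxE.
  transitivity (\sum_v (Num.sqrt (wdeg E w v) * (v \in S i)%:R / Num.sqrt (wvol E w (S i))) *
     (Num.sqrt (wdeg E w v) * (v \in S i')%:R / Num.sqrt (wvol E w (S i')))).
    rewrite [RHS](reindex (@enum_val V V)) /=; last exact: onW_bij (enum_val_bij V).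
    by apply: eq_bigr => j _; rewrite !mxE.
  have [<-|ii'] := eqVneq i i'.
    transitivity (\sum_(v in S i) wdeg E w v / wvol E w (S i)).
      rewrite [RHS]big_mkcond; apply: eq_bigr => v _; rewrite mulrACA -invfM mulrACA -!expr2 !sqr_sqrtr ?(ltW (volS i)) ?ltW //.
      by case: (v \in S i); rewrite ?expr1n ?expr0n ?mulr1 ?mulr0 ?mul0r.
    by rewrite -mulr_suml -/(wvol E w (S i)) divff // gt_eqF.
  rewrite big1 // => v _; have [vi|_] := boolP (v \in S i); last by rewrite mulr0 !mul0r.
  by rewrite (disjointFr (Sd _ _ ii') vi) mulr0 mul0r mulr0.
have QT : (X^T *m X)^T = X^T *m X by rewrite trmx_mul trmxK.
have QQ : X^T *m X *m (X^T *m X) = X^T *m X by rewrite mulmxA -(mulmxA _ X) XX mulmx1.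
have trQ : \tr (X^T *m X) = k%:R by rewrite mxtrace_mulC XX mxtrace1.
apply: le_trans (sum_smallest_le_trace (nlaplacian_sym E w c) k0 kV QT QQ trQ) _.
have -> : X^T *m X = X^T *m (X^T)^T by rewrite trmxK.
rewrite trace_nlaplacian.
pose f v (j : 'I_k) := (Num.sqrt (wdeg E w v))^-1 * X^T (enum_rank v) j; rewrite -/f.
have fE v j : f v j = (v \in S j)%:R / Num.sqrt (wvol E w (S j)).
  by rewrite /f !mxE enum_rankK mulrA mulKf // gt_eqF // sqrtr_gt0.
apply: (@le_trans _ _ (\sum_(e in E) w e * \sum_j (e \in boundary E (S j))%:R / wvol E w (S j))).
  apply: ler_sum => e eE; have [c0 csum] := cfeas e eE.
  have rhs0 : 0 <= \sum_j (e \in boundary E (S j))%:R / wvol E w (S j).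
    by apply: sumr_ge0 => j _; rewrite divr_ge0 // ltW.
  apply: le_trans (ler_wpM2r rhs0 csum); rewrite mulr_suml.
  apply: ler_sum => p pe; apply: ler_wpM2l; first exact: c0.
  move: pe; rewrite inE => /andP[/cards2P[u [v [uv ->]]] /fintype.subsetP pe].
  have ue : u \in e by apply: pe; rewrite set21.
  have ve : v \in e by apply: pe; rewrite set22.
  rewrite pair_energy2 //; apply: ler_sum => j _; rewrite !fE -mulrBl exprMn exprVn sqr_sqrtr ?(ltW (volS j)) //.
  rewrite ler_pM2r ?invr_gt0 // inE eE /=.
  have bd x y : x \in e -> y \in e -> x \in S j -> y \notin S j -> (e :&: S j != finset.set0) && (e :&: ~: S j != finset.set0).
    by move=> xe ye xS yS; apply/andP; split; apply/set0Pn; [exists x | exists y]; rewrite !inE ?xe ?ye.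
  have [uS|uS] := boolP (u \in S j); have [vS|vS] := boolP (v \in S j) => /=.
  - by rewrite subrr expr0n.
  - by rewrite (bd u v) // subr0 expr1n.
  - by rewrite (bd v u) // sub0r sqrrN expr1n.
  - by rewrite subrr expr0n.
under eq_bigr do rewrite mulr_sumr.
rewrite exchange_big; apply: ler_sum => j _ /=.
have -> : \sum_(e in E) w e * ((e \in boundary E (S j))%:R / wvol E w (S j)) = cut (S j) / wvol E w (S j).
  rewrite mulr_suml [LHS]big_mkcond [RHS]big_mkcond; apply: eq_bigr => e _.
  rewrite inE; case: (e \in E) => //=; case: (_ && _); rewrite ?mul1r //.
  by rewrite mul0r mulr0.
rewrite ler_wpM2l ?cut_ge0 // lef_pV2 ?posrE ?ge_min ?lexx //.
rewrite lt_min volS wvol_gt0 //; have [_ ST] := S0 j.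
by apply: contraNneq ST => SC; rewrite -(finset.setCK (S j)) SC finset.setC0.
Qed.
End Conductance.

Section HigherOrderCheeger.
Variables (R : realType) (V : finType) (E : {set {set V}}) (w : {set V} -> R) (k : nat).
Hypothesis w_ge0 : forall e, e \in E -> 0 <= w e.
Hypothesis wdeg_gt0 : forall v, 0 < wdeg E w v.
Hypothesis k_bounds : (2 <= k <= #|V|)%N.

Local Notation sigma := (sigma_star E w k).
Local Notation r := (rank_hyper E).

Let k_ge2 : (2 <= k)%N. Proof. by case/andP: k_bounds. Qed.
Let k_le_V : (k <= #|V|)%N. Proof. by case/andP: k_bounds. Qed.
Let V_ge2 : (2 <= #|V|)%N. Proof. exact: leq_trans k_le_V. Qed.
Let k_pos : (0 < k <= #|V|)%N. Proof. by rewrite (leq_trans _ k_ge2). Qed.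
Let k0 : 0 < k%:R :> R. Proof. by rewrite ltr0n; case/andP: k_pos. Qed.

Lemma feasible0 : feasible E w (fun _ _ => 0).
Proof. by move=> e eE; split => //; rewrite big1 // w_ge0. Qed.

Lemma sum_smallest_le_sigma_star c : feasible E w c ->
  sum_smallest_eigenvalues k (nlaplacian E w c) <= sigma.
Proof.
move=> cf; apply: sup_ubound; last by exists c.
have [S Sk _] := singleton_family V_ge2 k_le_V.
exists (\sum_i conductance E w (S i)) => _ [c' cf' ->].
exact: sum_smallest_le_conductance.
Qed.

Lemma sigma_star_le_conductance : (k%:R)^-1 * sigma <= kway_conductance E w k.
Proof.
apply: le_kway_conductance => // S Sk.
rewrite ler_pdivrMl //; apply: sup_le_ub.
  by eexists; exists (fun _ _ => 0); first exact: feasible0.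
move=> _ [c cf ->]; apply: le_trans (sum_smallest_le_conductance w_ge0 wdeg_gt0 k_pos cf Sk) _.
rewrite mulr_natl -[X in _ *+ X]card_ord -sumr_const; apply: ler_sum => i _.
exact: (le_bigmax_cond _ (fun i => conductance E w (S i))).
Qed.

Lemma sigma_star_ge0 : 0 <= sigma.
Proof.
apply/ler_addgt0Pr => delta delta0.
have [I [f [D [_ D0 _ sumD]]]] := spectral_embedding w_ge0 wdeg_gt0 k_le_V sum_smallest_le_sigma_star delta0.
by apply: le_trans sumD; apply: sumr_ge0 => e eE; rewrite mulr_ge0 ?w_ge0 ?D0.
Qed.

Lemma rank_hyperP e : e \in E -> (#|e| <= r)%N.
Proof. by move=> eE; apply: (@leq_bigmax_cond _ (mem E) (fun e => #|e|)). Qed.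

Section Perturbed.
Variables (eps delta : R) (m : nat).
Hypotheses (eps_lo : (2 * k%:R)^-1 <= eps) (eps_hi : eps < 2^-1) (delta0 : 0 < delta).
Hypotheses (r_ge2 : (2 <= r)%N) (m_ceil : forall g : nat, (1 - eps) * k%:R <= g%:R -> (m <= g)%N) (m_le : (m <= k)%N).

Let eps0 : 0 < eps. Proof. by apply: lt_le_trans eps_lo; rewrite invr_gt0 mulr_gt0. Qed.

Lemma hash_rate_ge1 : 1 <= hash_rate k r eps.
Proof.
have lnk := ln_ge_half R k_ge2; have lnr := ln_ge_half R r_ge2; have e0 := eps0; have eh := eps_hi.
have d0 : 0 < Num.sqrt (eps / 32) by rewrite sqrtr_gt0 divr_gt0.
have d1 : Num.sqrt (eps / 32) <= 1 by rewrite -[leRHS]sqrtr1 ler_sqrt //; lra.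
have q : 2^-1 <= Num.sqrt (ln r%:R : R).
  rewrite -ler_sqr ?nnegrE ?sqrtr_ge0 ?invr_ge0 // sqr_sqrtr; last lra.
  by apply: le_trans lnr; rewrite expr2 ler_piMr ?invr_ge0 // invf_le1 // ler1n.
rewrite /hash_rate ler_pdivlMr // mul1r; apply: (le_trans d1).
have : 2^-1 * 2^-1 <= ln k%:R * Num.sqrt (ln r%:R) :> R by apply: ler_pM; rewrite ?invr_ge0.
rewrite -mulrA; lra.
Qed.

Lemma cost_cutoff_le (s : R) : 0 < s ->
  4 * cost_cutoff k r eps s <= 128 * (hash_rate k r eps * Num.sqrt s / eps)
    + 171 * (hash_rate k r eps * Num.sqrt s / eps) ^+ 2.
Proof.
move=> s0; have X1 := hash_rate_ge1; have e0 := eps0; have eh := eps_hi.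
have kb : 1 <= Num.sqrt (k%:R : R) by rewrite -[leLHS]sqrtr1 ler_sqrt // ler1n; case/andP: k_pos.
have a0 : 0 < Num.sqrt s by rewrite sqrtr_gt0.
rewrite /cost_cutoff /total_cost /short_bound sqrtrM ?(ltW s0) //.
move: (hash_rate k r eps) (Num.sqrt s) (Num.sqrt k%:R) X1 kb a0
  (esym (sqr_sqrtr (ltW s0))) (esym (sqr_sqrtr (ltW k0))) => X a b X1 b1 a0 -> ->.
have b0 : 0 < b by lra.
have -> : 4 * (8 * (2 * ((2 + 4 * X) * (a * b)) + 16 * b ^+ 2 * X ^+ 2 * a ^+ 2) / (3 * eps * b ^+ 2)) =
   64 / 3 * ((2 + 4 * X) * a / eps) * b^-1 + 512 / 3 * (X * a / eps) ^+ 2 * eps.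
  by field; rewrite !gt_eqF.
have z0 : 0 <= X * a / eps by rewrite divr_ge0 ?mulr_ge0 ?(ltW a0) ?(ltW e0) //; lra.
apply: lerD.
  have h : (2 + 4 * X) * a / eps <= 6 * (X * a / eps).
    rewrite !mulrA ler_pM2r ?invr_gt0 // ler_pM2r //; lra.
  have h0 : 0 <= (2 + 4 * X) * a / eps by rewrite divr_ge0 ?mulr_ge0 ?(ltW a0) ?(ltW e0) //; lra.
  apply: (@le_trans _ _ (64 / 3 * ((2 + 4 * X) * a / eps))); last lra.
  by apply: ler_piMr; [lra | rewrite invf_le1].
have := sqr_ge0 (X * a / eps); move: (_ ^+ 2) => z2 z20; nra.
Qed.

Lemma kway_conductance_perturbed :
  kway_conductance E w m <= 299 * (hash_rate k r eps * Num.sqrt (sigma + delta) / eps).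
Proof.
have s0 : 0 < sigma + delta by apply: ltr_wpDl => //; apply: sigma_star_ge0.
have X1 := hash_rate_ge1; have e0 := eps0; have eh := eps_hi.
set Z := _ / eps; have Z0 : 0 <= Z.
  rewrite divr_ge0 ?(ltW e0) //; apply: mulr_ge0; [lra | exact: sqrtr_ge0].
have le1 : kway_conductance E w m <= 1.
  by apply: kway_conductance_le1 => //; apply: leq_trans k_le_V.
have [Z1|Z1] := lerP 1 Z; first lra.
have e1 : eps <= 1 by lra.
have [I [f [D [fiso D0 fD sumD]]]] := spectral_embedding w_ge0 wdeg_gt0 k_le_V sum_smallest_le_sigma_star delta0.
have [g [S [gk S0 Sd Scut]]] := sparse_sets w_ge0 wdeg_gt0 k_ge2 r_ge2 rank_hyperP fiso D0 fD s0 sumD eps_lo e1.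
have g2 : (2 <= g)%N.
  have k2 : 2 <= k%:R :> R by rewrite ler_nat.
  by rewrite -(ltr_nat R); apply: lt_le_trans gk; nra.
have b0 : 0 <= 4 * cost_cutoff k r eps (sigma + delta).
  by rewrite mulr_ge0 // divr_ge0 ?mulr_ge0 ?(ltW e0) ?(ltW k0) // ltW // total_cost_gt0.
have [S' S'k S'b] := disjoint_sparse_kway w_ge0 wdeg_gt0 g2 b0 S0 Sd Scut.
apply: (le_trans (kway_conductance_le (m_ceil gk) b0 S'k S'b)).
apply: (le_trans (cost_cutoff_le s0)); rewrite -/Z.
have : Z ^+ 2 <= Z by rewrite expr2 ler_piMr // ltW.
lra.
Qed.
End Perturbed.

Lemma kway_conductance_le_sigma_star (eps : R) (m : nat) : (2 * k%:R)^-1 <= eps -> eps < 2^-1 ->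
  (forall g : nat, (1 - eps) * k%:R <= g%:R -> (m <= g)%N) -> (m <= k)%N ->
  kway_conductance E w m <= 299 * 9216 * (eps ^+ 4)^-1 * (ln k%:R * Num.sqrt (ln r%:R * sigma)).
Proof.
move=> elo ehi mceil mk.
have e0 : 0 < eps by apply: lt_le_trans elo; rewrite invr_gt0 mulr_gt0.
have lnk0 : 0 <= ln k%:R :> R by rewrite ln_ge0 // ler1n; case/andP: k_pos.
have K0 : 0 <= 299 * 9216 * (eps ^+ 4)^-1 * ln k%:R.
  by rewrite !mulr_ge0 ?invr_ge0 ?exprn_ge0 ?(ltW e0).
have [r1|r2] := leqP r 1.
  apply: (@le_trans _ _ 0); last by rewrite mulrA mulr_ge0 ?sqrtr_ge0.
  apply: kway_conductance_trivial => //; first exact: leq_trans k_le_V.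
  by move=> e eE; apply: leq_trans r1; apply: rank_hyperP.
have lnr : 0 < ln r%:R :> R by have := ln_ge_half R r2; lra.
have d0 : 0 < Num.sqrt (eps / 32) by rewrite sqrtr_gt0 divr_gt0.
have bound delta : 0 < delta -> kway_conductance E w m <=
    299 * 9216 * (eps ^+ 4)^-1 * ln k%:R * Num.sqrt (ln r%:R * (sigma + delta)).
  move=> dl; apply: (le_trans (kway_conductance_perturbed elo ehi dl r2 mceil mk)).
  rewrite sqrtrM ?(ltW lnr) //.
  have -> : 299 * (hash_rate k r eps * Num.sqrt (sigma + delta) / eps) =
    299 * 1536 * (Num.sqrt (eps / 32) * eps)^-1 * ln k%:R * (Num.sqrt (ln r%:R) * Num.sqrt (sigma + delta)).
    by rewrite /hash_rate; field; rewrite !gt_eqF.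
  apply: ler_wpM2r; first by rewrite mulr_ge0 ?sqrtr_ge0.
  apply: ler_wpM2r => //.
  have -> : 299 * 9216 * (eps ^+ 4)^-1 = 299 * 1536 * (6 * (eps ^+ 4)^-1) by field; rewrite gt_eqF.
  have -> : 6 * (eps ^+ 4)^-1 = (eps ^+ 4 / 6)^-1 by field; rewrite gt_eqF.
  apply: ler_wpM2l; first lra.
  rewrite lef_pV2 ?posrE ?divr_gt0 ?mulr_gt0 ?exprn_gt0 //.
  have : eps / 6 <= Num.sqrt (eps / 32).
    rewrite -ler_sqr ?nnegrE ?sqrtr_ge0 ?divr_ge0 ?(ltW e0) // sqr_sqrtr ?divr_ge0 ?(ltW e0) //; nra.
  have e2 : eps ^+ 2 <= 1 by rewrite exprn_ile1 ?(ltW e0) //; lra.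
  have -> : eps ^+ 4 = eps ^+ 2 * (eps * eps) by ring.
  have ee : 0 <= eps * eps by rewrite mulr_ge0 // ltW.
  move=> h; have := ler_wpM2r (ltW e0) h; have := ler_wpM2r ee e2; lra.
rewrite mulrA; set K := 299 * 9216 * _ * _ in K0 bound *.
apply/ler_addgt0Pr => eta eta0.
have K1 : 0 < K + 1 by lra.
pose delta := (eta / (K + 1)) ^+ 2 / ln r%:R.
have dl : 0 < delta by rewrite divr_gt0 // exprn_gt0 // divr_gt0.
apply: (le_trans (bound _ dl)).
apply: (@le_trans _ _ (K * (Num.sqrt (ln r%:R * sigma) + eta / (K + 1)))).
  apply: ler_wpM2l => //.
  have p0 : 0 <= ln r%:R * sigma by rewrite mulr_ge0 ?sigma_star_ge0 // ltW.
  have q0 : 0 <= eta / (K + 1) by rewrite divr_ge0 ?ltW.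
  have t0 := sqrtr_ge0 (ln r%:R * sigma).
  rewrite -ler_sqr ?nnegrE ?sqrtr_ge0 ?addr_ge0 //.
  rewrite sqrrD !sqr_sqrtr //; last by rewrite mulr_ge0 ?(ltW lnr) // addr_ge0 ?sigma_star_ge0 ?ltW.
  rewrite mulrDr /delta mulrCA divff ?gt_eqF // mulr1.
  by rewrite addrAC lerDl mulrn_wge0 // mulr_ge0.
rewrite mulrDr lerD2l mulrCA ler_piMr ?(ltW eta0) // ler_pdivrMr //; lra.
Qed.
End HigherOrderCheeger.

Theorem theorem5p1 (R : realType) :
  exists2 C : R, 0 < C &
  forall (V : finType) (E : {set {set V}}) (w : {set V} -> R) (k : nat),
    (forall e, e \in E -> 0 <= w e) ->
    (forall v : V, 0 < wdeg E w v) ->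
    (2 <= k <= #|V|)%N ->
    [/\ (k%:R)^-1 * sigma_star E w k <= C * kway_conductance E w k,
        kway_conductance E w k <=
          C * (k%:R ^+ 4 * ln k%:R
               * Num.sqrt (ln (rank_hyper E)%:R * sigma_star E w k))
      & forall eps : R, (k%:R)^-1 <= eps -> eps < 1 ->
          kway_conductance E w `|Num.ceil ((1 - eps) * k%:R)|%N <=
          C * ((eps ^+ 4)^-1 * ln k%:R
               * Num.sqrt (ln (rank_hyper E)%:R * sigma_star E w k))].
Proof.
have C1 : 1 <= 16 * (299 * 9216) :> R by lra.
exists (16 * (299 * 9216)); first by lra.
move=> V E w k w_ge0 wdeg_gt0 kb.
have /andP[k2 kV] := kb; have k0 : 0 < k%:R :> R by rewrite ltr0n (leq_trans _ k2).
have k2R : 2 <= k%:R :> R by rewrite ler_nat.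
have core := kway_conductance_le_sigma_star w_ge0 wdeg_gt0 kb.
split.
- apply: le_trans (sigma_star_le_conductance w_ge0 wdeg_gt0 kb) _.
  rewrite ler_peMl //; apply: le_kway_conductance => //; first exact: leq_trans kV.
  by move=> S _; apply: bigmax_ge_id.
- have e1 : (2 * k%:R)^-1 < 2^-1 :> R by rewrite ltf_pV2 ?posrE ?mulr_gt0 //; lra.
  have ceil_k (g : nat) : (1 - (2 * k%:R)^-1) * k%:R <= g%:R :> R -> (k <= g)%N.
    rewrite mulrBl mul1r invfM -mulrA mulVf ?gt_eqF // mulr1 => gk.
    rewrite leqNgt; apply/negP; rewrite -(ler_nat R) -natr1; lra.
  apply: (le_trans (core _ k (lexx _) e1 ceil_k (leqnn k))).
  rewrite le_eqVlt; apply/orP; left; apply/eqP.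
  by move: (ln k%:R) (Num.sqrt _) => a b; field; rewrite gt_eqF.
- move=> eps elo ehi.
  have e0 : 0 < eps by apply: lt_le_trans elo; rewrite invr_gt0.
  have ceil_le (g : nat) : (1 - eps) * k%:R <= g%:R -> (`|Num.ceil ((1 - eps) * k%:R)| <= g)%N.
    move=> h; have c0 : (0 <= Num.ceil ((1 - eps) * k%:R))%R.
      by rewrite ceil_ge0 (lt_le_trans (ltrN10 _)) // mulr_ge0 // subr_ge0 ltW.
    by rewrite -lez_nat gez0_abs // ceil_le_int.
  apply: (le_trans (core (eps / 2) _ _ _ _ _)).
  - by rewrite invfM mulrC ler_pM2r ?invr_gt0.
  - lra.
  - by move=> g h; apply: ceil_le; apply: le_trans h; rewrite ler_pM2r //; lra.
  - by apply: ceil_le; rewrite ler_piMl //; lra.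
  - rewrite le_eqVlt; apply/orP; left; apply/eqP.
    by move: (ln k%:R) (Num.sqrt _) => a b; field; rewrite gt_eqF.
Qed.
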